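(* Let $a\in\mathbb{R}$ and suppose that $\{\lambda_i,\varphi_i(a)\}_{i=1}^N$ is the interior spectral data at $a$ of some pair $(\omega,v)$, with $\varphi_i(a)\neq0$ for all $i=1,\dots,N$. Consider the pairs $(\tilde\omega,\tilde v)$ whose interior spectral data $\{\tilde\lambda_i,\tilde\varphi_i(a)\}_{i=1}^N$ at $a$ satisfies $$\tilde\lambda_i=\lambda_i,\qquad |\tilde\varphi_i(a)|=|\varphi_i(a)|,\qquad i=1,\dots,N. \quad ( * )$$ (i) If $\alpha=\beta=0$, then there are precisely $2^{N-2}$ pairs $(\tilde\omega,\tilde v)$ satisfying $( * )$. (ii) If $\alpha=0$ and $\beta\neq0$, then there are precisely $2^{N-1}$ pairs $(\tilde\omega,\tilde v)$ satisfying $( * )$. (iii) If $\alpha\neq0$, then there are precisely $2^{N}$ pairs $(\tilde\omega,\tilde v)$ satisfying $( * )$.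
   Context: A pair $(\omega,v)$ means: for some $n\in\mathbb{N}$, $n\ge 1$, and real points $x_1<\dots<x_n$, $\omega=\sum_{i=1}^n\omega_i\delta_{x_i}$ and $v=\sum_{i=1}^n v_i\delta_{x_i}$ with $\omega_i\in\mathbb{R}$, $v_i\ge 0$ and $|\omega_i|+v_i>0$ ($\delta_x$ is the Dirac measure at $x$). The number $n$, the points and the weights may differ from pair to pair. For $z\in\mathbb{C}$ consider $-f''+\frac14 f=z\omega f+z^2vf$ on $\mathbb{R}$, meaning: $f$ is continuous, $-f''+\frac14 f=0$ on $\mathbb{R}\setminus\{x_1,\dots,x_n\}$, and $f'(x_i-)=f'(x_i+)+z\omega_if(x_i)+z^2v_if(x_i)$ for every $i$. An eigenvalue is a $z$ for which there is a nontrivial bounded solution. The eigenvalues form a finite set of nonzero real numbers $\lambda_1<\dots<\lambda_N$. For $z\in\mathbb{C}$, $\phi_\pm(z,\cdot)$ are the solutions with $\phi_\pm(z,x)=e^{\mp x/2}$ for all $x$ near $\pm\infty$. For an eigenvalue $\lambda$ put $\gamma_\lambda^2:=\int_{\mathbb{R}}|\phi_+(\lambda,x)|^2d\omega(x)+2\lambda\int_{\mathbb{R}}|\phi_+(\lambda,x)|^2dv(x)$; one has $\lambda\gamma_\lambda^2>0$. The normalized eigenfunctions are $\varphi_i(x)=\phi_+(\lambda_i,x)/\sqrt{\lambda_i\gamma_{\lambda_i}^2}$. For $a\in\mathbb{R}$, the family $\{\lambda_i,\varphi_i(a)\}_{i=1}^N$ is called the interior spectral data of $(\omega,v)$ at $a$;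 quantities with a tilde are the analogous ones for the pair $(\tilde\omega,\tilde v)$ (which, in $( * )$, has exactly $N$ eigenvalues). Put $\alpha:=1-\sum_{i=1}^N|\varphi_i(a)|^2$ and $\beta:=-\sum_{i=1}^N\lambda_i|\varphi_i(a)|^2$. *)

(* Defs.v *)
From HB Require Import structures.
From mathcomp Require Import all_boot all_order all_algebra.
From mathcomp Require Import all_classical all_reals all_analysis.
From mathcomp Require Import complex.

Set Implicit Arguments.
Unset Strict Implicit.
Unset Printing Implicit Defensive.

Import Order.TTheory GRing.Theory Num.Theory.
Import numFieldNormedType.Exports.

Local Open Scope classical_set_scope.
Local Open Scope ring_scope.
Local Open Scope complex_scope.

(* A pair (omega, v) of discrete measures
     omega = \sum_i omega_i \d_(x_i),   v = \sum_i v_i \d_(x_i)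
   is the list of the triples (x_i, omega_i, v_i). Since [is_pair] requires the
   x_i to be strictly increasing and no (omega_i, v_i) to vanish, each pair of
   measures corresponds to exactly one list, so that counting lists is counting
   pairs of measures. *)
Definition pair_data (R : realType) : Type := seq (R * R * R).

Definition site (R : realType) (s : R * R * R) : R := s.1.1.
Definition omega_at (R : realType) (s : R * R * R) : R := s.1.2.
Definition v_at (R : realType) (s : R * R * R) : R := s.2.

Definition is_pair (R : realType) (p : pair_data R) : Prop :=
  [/\ (0 < size p)%N,
      sorted <%R [seq site s | s <- p] &
      forall s, s \in p -> 0 <= v_at s /\ 0 < `|omega_at s| + v_at s].

Definition integral_omega (R : realType) (p : pair_data R) (g : R -> R) : R :=
  \sum_(s <- p) omega_at s * g (site s).
Definition integral_v (R : realType) (p : pair_data R) (g : R -> R) : R :=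
  \sum_(s <- p) v_at s * g (site s).

(* Limits, continuity and derivatives of complex-valued functions of a real
   variable are taken on the real and imaginary parts: the library has no normed
   space structure over R on R[i]. *)
Definition cvgC (R : realType) (f : R -> R[i]) (F : set_system R) (l : R[i]) :
    Prop :=
  (fun x => complex.Re (f x)) @ F --> complex.Re l /\
  (fun x => complex.Im (f x)) @ F --> complex.Im l.

Definition continuousC (R : realType) (f : R -> R[i]) : Prop :=
  continuous (fun x => complex.Re (f x)) /\
  continuous (fun x => complex.Im (f x)).

Definition derivableC (R : realType) (f : R -> R[i]) (x : R) : Prop :=
  derivable (fun y => complex.Re (f y)) x 1 /\
  derivable (fun y => complex.Im (f y)) x 1.

Definition deriveC (R : realType) (f : R -> R[i]) (x : R) : R[i] :=
  Complex (derive1 (fun y => complex.Re (f y)) x)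
          (derive1 (fun y => complex.Im (f y)) x).

(* - f'' + f / 4 = z omega f + z ^ 2 v f *)
Definition is_solution (R : realType) (p : pair_data R) (z : R[i])
    (f : R -> R[i]) : Prop :=
  [/\ continuousC f,
      forall x, x \notin [seq site s | s <- p] ->
        [/\ derivableC f x, derivableC (deriveC f) x &
            - deriveC (deriveC f) x + 4^-1 * f x = 0] &
      forall s, s \in p -> exists l r : R[i],
        [/\ cvgC (deriveC f) (site s)^'- l,
            cvgC (deriveC f) (site s)^'+ r &
            l = r + z * (omega_at s)%:C * f (site s)
                  + z ^+ 2 * (v_at s)%:C * f (site s)]].

Definition is_eigenvalue (R : realType) (p : pair_data R) (z : R[i]) : Prop :=
  exists f : R -> R[i],
    [/\ is_solution p z f,
        exists x, f x != 0 &
        exists M : R, forall x, Normc.normc (f x) <= M].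

(* The solution of the differential equation equal to exp (- x / 2) near +oo;
   it exists and is unique, so the default value of [xget] is irrelevant. *)
Definition phi_plus (R : realType) (p : pair_data R) (z : R[i]) : R -> R[i] :=
  xget (fun _ : R => (0 : R[i]))
    [set f | is_solution p z f /\
             \forall x \near +oo, f x = (expR (- x / 2))%:C].

Definition gamma_sq (R : realType) (p : pair_data R) (lam : R) : R :=
  integral_omega p (fun x => Normc.normc (phi_plus p lam%:C x) ^+ 2) +
  2 * lam * integral_v p (fun x => Normc.normc (phi_plus p lam%:C x) ^+ 2).

Definition normalized_eigenfunction (R : realType) (p : pair_data R) (lam : R)
    (x : R) : R[i] :=
  phi_plus p lam%:C x / (Num.sqrt (lam * gamma_sq p lam))%:C.

Definition eigenvalue_enumeration (R : realType) (p : pair_data R) (N : nat)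
    (lam : 'I_N -> R) : Prop :=
  (forall i j : 'I_N, (i < j)%N -> lam i < lam j) /\
  (forall z : R[i], is_eigenvalue p z <-> exists i, z = (lam i)%:C).

Definition interior_spectral_data (R : realType) (p : pair_data R) (a : R)
    (N : nat) (lam : 'I_N -> R) (phi : 'I_N -> R[i]) : Prop :=
  eigenvalue_enumeration p lam /\
  forall i, phi i = normalized_eigenfunction p (lam i) a.

Definition alpha (R : realType) (N : nat) (phi : 'I_N -> R[i]) : R :=
  1 - \sum_(i < N) Normc.normc (phi i) ^+ 2.

Definition beta (R : realType) (N : nat) (lam : 'I_N -> R)
    (phi : 'I_N -> R[i]) : R :=
  - \sum_(i < N) lam i * Normc.normc (phi i) ^+ 2.

Definition pairs_with_data (R : realType) (a : R) (N : nat) (lam : 'I_N -> R)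
    (phi : 'I_N -> R[i]) : set (pair_data R) :=
  [set q | is_pair q /\
     exists (lam' : 'I_N -> R) (phi' : 'I_N -> R[i]),
       interior_spectral_data q a lam' phi' /\
       forall i, lam' i = lam i /\ Normc.normc (phi' i) = Normc.normc (phi i)].

(* Main.v *)
Require Import Defs.
From mathcomp Require Import all_boot all_order all_algebra.
From mathcomp Require Import all_classical all_reals all_analysis.
From mathcomp Require Import complex.
From mathcomp Require Import ring lra.
Import Order.TTheory GRing.Theory Num.Theory.
Import numFieldNormedType.Exports.
Local Open Scope classical_set_scope.
Local Open Scope ring_scope.
Local Open Scope complex_scope.

(** Between two sites a solution is u e^{-x/2} + w e^{x/2}, and crossing a site
    of weights omega, v multiplies (u, w) by a matrix of determinant 1 that
    depends on z through kappa = z omega + z^2 v only. To the left of all sites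
    the coefficients of phi_+ are therefore polynomials in z. The coefficient V
    of e^{-x/2}, which is unbounded there, is the Wronskian of phi_+ and phi_-,
    and the eigenvalues are its complex roots ([eigenvalueP]).

    Put A = e^{a/2} phi_+(z, a), B = e^{-a/2} phi_-(z, a) and K = A B, so that
    K / V is the Green function on the diagonal at a. The Lagrange identity
    turns gamma^2 into a multiple of V' at an eigenvalue, whence K / V has the
    residue - lam_i |varphi_i(a)|^2 at lam_i ([green_residue]). Since
    deg K <= deg V = N and K(0) = V(0) = 1, the polynomial K is known from its
    values at 0 and at the lam_i; when no varphi_i(a) vanishes, prescribing the
    spectral data up to the signs is the same as prescribing V and K
    ([pairs_with_dataE]).

    It remains to count the pairs with given V and K. The sites to the right of
    a produce A together with a second polynomial U, the derivative at a of
    e^{-x/2} phi_+ in the coordinate y = e^{-x}; those to the left produce B and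
    L in the same way, and a site at a contributes its kappa:

        V / K = U / A + L / B - 1 - kappa                       ([slope_split]).

    The functions - U / (z A) and - L / (z B) are rational Herglotz functions,
    and they are exactly the ones that a half-line produces, each half-line
    being recovered by the continued fraction expansion of U / A
    ([halfline_inj], [halfline_surj]). This rests on one fact: if F is Herglotz,
    so is - 1 / F ([herglotz_inv]).

    By hypothesis V and K have no common root, so A and B have none either, and
    each root of K, which is real and simple, belongs to exactly one of A and B.
    Once the roots of A are chosen, A and B are known, then U from
    U B = V at the roots of A, U(0) = 1 and deg U <= deg A, likewise L, and
    finally kappa: the pair is determined ([weak_pair_unique]). Every choice is
    possible ([weak_pair_exists]), because the sign condition that makes
    - U / (z A) Herglotz reads V(x) x K'(x) > 0 at the roots x of K, and this
    does not see how the roots are distributed. So there are 2 ^ deg K pairs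
    ([card_isospectral]). Finally K = alpha V + sum_i lam_i |varphi_i(a)|^2
    V / (lam_i - z), which gives deg K = N, N - 1 or N - 2 in the three cases
    ([size_green_num]). *)

Set Implicit Arguments.
Unset Strict Implicit.
Unset Printing Implicit Defensive.

(** * Rational Herglotz functions *)

Section SimpleRealRoots.
Variable R : rcfType.
Implicit Types (f g h : {poly R}) (ps : seq R) (x y : R).

Definition simple_roots g ps :=
  [/\ g != 0, uniq ps & g = lead_coef g *: \prod_(p <- ps) ('X - p%:P)].

Lemma simple_roots_root g ps x : simple_roots g ps -> root g x = (x \in ps).
Proof.
by case=> g0 _ ->; rewrite rootZ ?lead_coef_eq0// root_prod_XsubC.
Qed.

Lemma simple_roots_size g ps : simple_roots g ps -> size g = (size ps).+1.
Proof.
by case=> g0 _ ->; rewrite size_scale ?lead_coef_eq0// size_prod_XsubC.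
Qed.

(** The factor g / (X - x) of g at a root x; its value at x is g'(x). *)
Definition cofactor g x := g %/ ('X - x%:P).

Lemma cofactorK g x : root g x -> g = cofactor g x * ('X - x%:P).
Proof. by move=> gx; rewrite divpK// dvdp_XsubCl. Qed.

Lemma deriv_cofactor g x : root g x -> g^`().[x] = (cofactor g x).[x].
Proof.
move=> /cofactorK {1}->; rewrite derivM derivXsubC mulr1 hornerD hornerM.
by rewrite hornerXsubC subrr mulr0 add0r.
Qed.

Lemma size_cofactor g x : size (cofactor g x) = (size g).-1.
Proof. by rewrite size_divp ?polyXsubC_eq0// size_XsubC subn1. Qed.

Lemma cofactor_root g x y : root g x -> root g y -> y != x ->
  (cofactor g x).[y] = 0.
Proof.
move=> gx /rootP gy yx; apply/eqP; move/eqP: gy; rewrite (cofactorK gx).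
by rewrite hornerM mulf_eq0 hornerXsubC subr_eq0 (negPf yx) orbF -cofactorK.
Qed.

Lemma lead_coef_cofactor g x : root g x ->
  lead_coef (cofactor g x) = lead_coef g.
Proof. by move=> gx; rewrite {2}(cofactorK gx) lead_coef_Mmonic// monicXsubC.
Qed.

Lemma simple_roots_deriv g ps x : simple_roots g ps -> root g x ->
  g^`().[x] != 0.
Proof.
move=> sg gx; have := gx; rewrite (simple_roots_root _ sg) => xps.
have [g0 ups eg] := sg; rewrite {1}eg (big_rem x)//= derivZ hornerZ derivM.
rewrite derivXsubC mul1r hornerD hornerM hornerXsubC subrr mul0r addr0.
rewrite mulf_neq0 ?lead_coef_eq0// -rootE root_prod_XsubC.
by rewrite mem_rem_uniq// inE eqxx.
Qed.

(** Over the complex numbers g splits into linear factors, which are all real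
    here, and the derivative excludes multiple ones. *)
Lemma simple_roots_exist g : g != 0 ->
  (forall z : R[i], root (map_poly (real_complex R) g) z -> complex.Im z = 0) ->
  (forall x, root g x -> g^`().[x] != 0) ->
  exists ps, simple_roots g ps.
Proof.
move=> g0 greal gsimple.
have [zs] := closed_field_poly_normal (map_poly (real_complex R) g).
rewrite lead_coef_map => ezs.
have g0' : map_poly (real_complex R) g != 0 by rewrite map_poly_eq0.
pose ps := [seq complex.Re z | z <- zs].
have zsE : zs = [seq (real_complex R) x | x <- ps].
  rewrite -map_comp -[LHS]map_id; apply/eq_in_map => z zzs /=.
  have : complex.Im z = 0.
    apply: greal; rewrite ezs rootZ ?root_prod_XsubC//.
    by rewrite fmorph_eq0 lead_coef_eq0.
  by case: z {zzs} => a b /= ->.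
have eg : g = lead_coef g *: \prod_(p <- ps) ('X - p%:P).
  apply: (map_poly_inj (real_complex R)); rewrite ezs map_polyZ; congr (_ *: _).
  rewrite rmorph_prod zsE big_map; apply: eq_bigr => i _.
  by rewrite rmorphB /= map_polyX map_polyC.
exists ps; split=> //.
have uniq_rem (s : seq R) : (forall x, x \in s -> x \notin rem x s) -> uniq s.
  elim: s => //= y s IH nrem; have := nrem y; rewrite /= mem_head eqxx => ->
    //=.
  apply: IH => x xs; have := nrem x; rewrite in_cons xs orbT => /(_ isT).
  rewrite /=; case: (y == x); first by rewrite xs.
  by rewrite in_cons negb_or => /andP[].
apply: uniq_rem => x xps.
have gx : root g x by rewrite eg rootZ ?lead_coef_eq0// root_prod_XsubC.
have cE : cofactor g x = lead_coef g *: \prod_(p <- rem x ps) ('X - p%:P).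
  have /mulIf : ('X - x%:P) != 0 by rewrite polyXsubC_eq0.
  by apply; rewrite -cofactorK// {1}eg (big_rem x)//= mulrC scalerAl.
have := gsimple _ gx; rewrite deriv_cofactor// cE -rootE rootZ ?lead_coef_eq0//.
by rewrite root_prod_XsubC.
Qed.

Lemma size2_polyE h : (size h <= 2)%N -> h = h`_1 *: 'X + (h`_0)%:P.
Proof.
move=> h2; apply/polyP => -[|[|i]]; rewrite coefD coefZ coefX coefC /= ?mulr0
  ?mulr1 ?add0r ?addr0//.
by rewrite nth_default// (leq_trans h2).
Qed.

Lemma size_divp_le2 f g : g != 0 -> (size f <= (size g).+1)%N ->
  (size (f %/ g)%R <= 2)%N.
Proof.
move=> g0 szf; rewrite size_divp// leq_subLR (leq_trans szf)//.
by rewrite -(prednK (_ : 0 < size g)%N) ?size_poly_gt0// addn2.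
Qed.

Lemma coef1_divp f g : g != 0 -> (size f <= (size g).+1)%N ->
  (f %/ g)`_1 = f`_(size g) / lead_coef g.
Proof.
move=> g0 szf; have szq := size_divp_le2 g0 szf.
have modlt : (size (f %% g)%R < size g)%N by rewrite ltn_modp.
rewrite {2}(divp_eq f g) {2}(size2_polyE szq) mulrDl !coefD -scalerAl coefZ.
rewrite mul_polyC coefZ coefXM size_poly_eq0 (negPf g0).
rewrite [g`_(size g)]nth_default// mulr0 addr0 [(f %% g)`_ _]nth_default ?addr0
  1?ltnW//.
by rewrite mulfK// lead_coef_eq0.
Qed.

(** The polynomial part is the quotient of f by g. The remainder is determined
    by its values at the roots of g, where every cofactor but one vanishes. *)
Lemma partial_fractions f g ps : simple_roots g ps ->
  (size f <= (size g).+1)%N ->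
  exists b, f = ((f`_(size g) / lead_coef g) *: 'X + b%:P) * g
            + \sum_(p <- ps) (f.[p] / g^`().[p]) *: cofactor g p.
Proof.
move=> sg szf; have [g0 ups _] := sg.
have modlt : (size (f %% g)%R < size g)%N by rewrite ltn_modp.
exists (f %/ g)`_0.
rewrite -coef1_divp// -size2_polyE ?size_divp_le2// {1}(divp_eq f g);
  congr (_ + _).
apply/eqP; rewrite -subr_eq0; apply/eqP/(@roots_geq_poly_eq0 _ _ ps) => //.
  apply/allP => p pps; have gp : root g p by rewrite (simple_roots_root _ sg).
  rewrite rootE hornerD hornerN horner_sum (big_rem p)//= big_seq big1 => [|y].
    rewrite addr0 hornerZ -deriv_cofactor// divfK ?(simple_roots_deriv sg)//.
    by rewrite {2}(divp_eq f g) hornerD hornerM (rootP gp) mulr0 add0r subrr.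
  rewrite mem_rem_uniq// inE => /andP[yp yps]; rewrite hornerZ.
  by rewrite cofactor_root ?mulr0 ?(simple_roots_root _ sg)// eq_sym.
rewrite (leq_trans (size_polyD _ _))// -ltnS -(simple_roots_size sg) gtn_max
  modlt.
rewrite size_polyN; apply: (big_ind (fun h : {poly R} => (size h < size g)%N)).
- by rewrite size_poly0 size_poly_gt0.
- by move=> h1 h2 l1 l2; rewrite (leq_ltn_trans (size_polyD _ _))// gtn_max l1.
- move=> p _; rewrite (leq_ltn_trans (size_scale_leq _ _))// size_cofactor.
  by rewrite prednK ?size_poly_gt0.
Qed.

(** The quotient f / g is a X + b plus a sum of terms r / (p - X) with a >= 0
    and all r > 0. Stated on the numerator and the denominator: r = - f(p) /
    g'(p), and a is the coefficient of f in degree [size g] = deg g + 1 over the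
    leading coefficient of g. *)
Definition herglotz f g :=
  exists2 ps, simple_roots g ps &
    [/\ forall p, root g p -> f.[p] * g^`().[p] < 0,
        (size f <= (size g).+1)%N & 0 <= f`_(size g) * lead_coef g].

Lemma herglotz_shift f g h : (size h <= 2)%N ->
  0 <= (f + h * g)`_(size g) * lead_coef g ->
  herglotz f g -> herglotz (f + h * g) g.
Proof.
move=> h2 slope [ps sg [sgn szf _]]; exists ps => //; split=> //.
  by move=> p gp; rewrite hornerD hornerM (rootP gp) mulr0 addr0; apply: sgn.
rewrite (leq_trans (size_polyD _ _))// geq_max szf/=.
rewrite (leq_trans (size_polyMleq _ _))// -subn1 leq_subLR add1n -addn2 addnC.
by rewrite leq_add2l.
Qed.

Lemma herglotz_scale f g c : 0 < c -> herglotz f g -> herglotz (c *: f) g.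
Proof.
move=> c0 [ps sg [sgn szf slope]]; exists ps => //; split.
- by move=> p gp; rewrite hornerZ -mulrA pmulr_rlt0// sgn.
- by rewrite (leq_trans (size_scale_leq _ _)).
- by rewrite coefZ -mulrA mulr_ge0// ltW.
Qed.

(** At a zero x of f the derivative of f / g is a + sum of r / (p - x) ^ 2, at
    least the slope a, with equality only if f / g has no pole. *)
Lemma herglotz_deriv_root f g x : herglotz f g -> root f x ->
  f`_(size g) / lead_coef g * g.[x] ^+ 2 <= f^`().[x] * g.[x]
    ?= iff (size g == 1).
Proof.
move=> [ps sg [sgn szf _]] fx; have gx : ~~ root g x.
  apply/negP => gx; have := sgn _ gx; rewrite (rootP fx) mul0r ltxx//.
have px p : p \in ps -> x - p != 0.
  move=> pps; rewrite subr_eq0; apply: contraNneq gx => ->.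
  by rewrite (simple_roots_root _ sg).
have cofE p : p \in ps -> (cofactor g p).[x] = g.[x] / (x - p).
  move=> pps; have gp : root g p by rewrite (simple_roots_root _ sg).
  by rewrite {2}(cofactorK gp) hornerM hornerXsubC mulfK// px.
have [b ef] := partial_fractions sg szf.
set a := f`_(size g) / lead_coef g in ef *; pose m p := f.[p] / g^`().[p].
have m_lt0 p : p \in ps -> m p < 0.
  move=> pps; have gp : root g p by rewrite (simple_roots_root _ sg).
  have g'p := simple_roots_deriv sg gp.
  by rewrite /m -(pmulr_llt0 _ (_ : 0 < g^`().[p] ^+ 2)) ?exprn_even_gt0//
    expr2 mulrA divfK// sgn.
(* f(x) = 0 expresses b, and then X - x factors out of f *)
have Fx : b = - (a * x) - \sum_(p <- ps) m p / (x - p).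
  apply: (mulIf gx); rewrite mulrBl; apply/eqP; rewrite eq_sym subr_eq.
  apply/eqP; move/rootP: fx; rewrite {1}ef hornerD hornerM hornerD hornerZ
    hornerX.
  rewrite hornerC horner_sum mulrDl => /eqP; rewrite -addrA addr_eq0 => /eqP.
  rewrite mulNr => ->; rewrite opprK; congr (_ + _); rewrite mulr_suml !big_seq.
  by apply: eq_bigr => p pps; rewrite hornerZ cofE// mulrA mulrAC.
pose h := a *: g - \sum_(p <- ps) (m p / (x - p)) *: cofactor g p.
have fh : f = ('X - x%:P) * h.
  have key p : p \in ps -> m p *: cofactor g p =
      (m p / (x - p)) *: g - (m p / (x - p)) *: (('X - x%:P) * cofactor g p).
    move=> pps; have gp : root g p by rewrite (simple_roots_root _ sg).
    rewrite {2}(cofactorK gp) -!mul_polyC -mulrBr [cofactor g p * _]mulrC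
      -mulrBl.
    have -> : 'X - p%:P - ('X - x%:P) = (x - p)%:P by rewrite polyCB; ring.
    by rewrite mulrA -polyCM divfK// px.
  rewrite {1}ef Fx /h.
  have -> : \sum_(p <- ps) (f.[p] / g^`().[p]) *: cofactor g p =
      (\sum_(p <- ps) m p / (x - p)) *: g -
      ('X - x%:P) * \sum_(p <- ps) (m p / (x - p)) *: cofactor g p.
    rewrite scaler_suml mulr_sumr -sumrB !big_seq; apply: eq_bigr => p pps.
    by rewrite -scalerAr -key.
  by rewrite -!mul_polyC polyCB polyCN (polyCM a x); ring.
have -> : f^`().[x] = h.[x].
  by rewrite fh derivM derivXsubC mul1r hornerD hornerM hornerXsubC subrr mul0r
    addr0.
have -> : h.[x] * g.[x] =
    a * g.[x] ^+ 2 + g.[x] ^+ 2 * \sum_(p <- ps) (- m p / (x - p) ^+ 2).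
  rewrite /h hornerD hornerN hornerZ horner_sum mulrDl mulNr expr2 mulrA.
  congr (_ + _); rewrite mulr_suml -sumrN mulr_sumr !big_seq.
  apply: eq_bigr => p pps; rewrite hornerZ cofE//; have := px _ pps.
  by move=> ?; field.
have terms p : p \in ps -> 0 < - m p / (x - p) ^+ 2.
  move=> pps; rewrite divr_gt0 ?oppr_gt0 ?m_lt0//.
  by rewrite exprn_even_gt0//= px.
have g2 : 0 < g.[x] ^+ 2 by rewrite exprn_even_gt0//= -rootE.
split; first by rewrite lerDl mulr_ge0 ?sqr_ge0// big_seq sumr_ge0// => p
  /terms/ltW.
rewrite (simple_roots_size sg) eqSS eq_sym -subr_eq0 addrC addKr mulf_eq0
  gt_eqF//=.
rewrite big_seq psumr_eq0 => [|p /terms/ltW//].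
apply/idP/idP => [/allP z|]; last by rewrite size_eq0 => /eqP ->.
case: (ps) terms z => // p qs terms /(_ p (mem_head _ _)).
by rewrite mem_head gt_eqF ?terms ?mem_head.
Qed.

Lemma herglotz_residue_lt0 f g p : herglotz f g -> root g p ->
  f.[p] / g^`().[p] < 0.
Proof.
move=> [ps sg [sgn _ _]] gp; have g'p := simple_roots_deriv sg gp.
rewrite -(pmulr_llt0 _ (_ : 0 < g^`().[p] ^+ 2)) ?exprn_even_gt0//.
by rewrite expr2 mulrA divfK// sgn.
Qed.

Lemma herglotz_slope_ge0 f g : herglotz f g -> 0 <= f`_(size g) / lead_coef g.
Proof.
move=> [ps [g0 _ _] [_ _ slope]].
have l0 : lead_coef g != 0 by rewrite lead_coef_eq0.
rewrite -(pmulr_lge0 _ (_ : 0 < lead_coef g ^+ 2)) ?exprn_even_gt0//.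
by rewrite expr2 mulrA divfK.
Qed.

(** Off the real axis the imaginary part of f / g is Im z times a nonnegative
    number, which vanishes only if f / g is constant. *)
Lemma herglotz_real_roots f g (z : R[i]) : herglotz f g -> f != 0 ->
  root (map_poly (real_complex R) f) z -> complex.Im z = 0.
Proof.
move=> H; have [ps sg [_ szf _]] := H => f0 fz; apply/eqP/negPn/negP => y0.
have [b ef] := partial_fractions sg szf.
have a0 := herglotz_slope_ge0 H; set a := _ / _ in ef a0.
pose m p := f.[p] / g^`().[p].
have m_lt0 p : p \in ps -> m p < 0.
  by rewrite -(simple_roots_root _ sg) => /(herglotz_residue_lt0 H).
have zp p : z - p%:C != 0.
  by apply: contraNneq y0 => /subr0_eq ->.
have gz : (map_poly (real_complex R) g).[z] != 0.
  have [g0 _ ->] := sg; rewrite map_polyZ hornerZ mulf_neq0//.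
    by rewrite fmorph_eq0 lead_coef_eq0.
  rewrite rmorph_prod horner_prod prodf_seq_neq0; apply/allP => p _ /=.
  by rewrite rmorphB /= map_polyX map_polyC hornerXsubC zp.
have E : a%:C * z + b%:C + \sum_(p <- ps) (m p)%:C / (z - p%:C) = 0.
  apply: (mulIf gz); rewrite mul0r -[RHS](rootP fz) [in RHS]ef.
  rewrite (rmorphD (map_poly (real_complex R))) /=.
  rewrite (rmorphM (map_poly (real_complex R))).
  rewrite (rmorphD (map_poly (real_complex R))) /=.
  rewrite map_polyZ map_polyX map_polyC hornerD hornerM hornerD hornerZ hornerX.
  rewrite hornerC mulrDl; congr (_ + _); rewrite raddf_sum horner_sum mulr_suml.
  rewrite !big_seq; apply: eq_bigr => p pps.
  have gp : root g p by rewrite (simple_roots_root _ sg).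
  rewrite /= map_polyZ hornerZ {1}(cofactorK gp)
    (rmorphM (map_poly (real_complex R))).
  rewrite rmorphB /= map_polyX map_polyC.
  by rewrite hornerM hornerXsubC [_.[z] * _]mulrC mulrA divfK.
(* w p is the contribution of the pole p to Im (f / g) / Im z *)
pose w p := - m p / ((complex.Re z - p) ^+ 2 + complex.Im z ^+ 2).
have w_gt0 p : p \in ps -> 0 < w p.
  move=> pps; rewrite divr_gt0 ?oppr_gt0 ?m_lt0//.
  by rewrite ltr_wpDl ?sqr_ge0// exprn_even_gt0.
have : complex.Im z * (a + \sum_(p <- ps) w p) = 0.
  have := congr1 (@complex.Im R) E; rewrite !raddfD /= raddf_sum /= => ImE;
    rewrite -[RHS]ImE.
  rewrite mulrDr mulr_sumr; congr (_ + _).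
    by case: (z) => x y /=; ring.
  apply: eq_bigr => p _; rewrite /w; case: (z) => x y /=.
  by rewrite subr0 mul0r addr0; ring.
move=> /eqP; rewrite mulf_eq0 (negPf y0)/= paddr_eq0//; last first.
  by rewrite big_seq sumr_ge0// => p /w_gt0/ltW.
rewrite big_seq psumr_eq0 => [|p /w_gt0/ltW//] => /andP[/eqP a00 /allP w0].
have ps0 : ps = [::].
  case: (ps) w0 w_gt0 => // p qs /(_ p (mem_head _ _)); rewrite mem_head.
  by move=> /eqP wp /(_ p (mem_head _ _)); rewrite wp ltxx.
move: ef f0 fz; rewrite -/a a00 scale0r add0r ps0 big_nil addr0 => ->.
rewrite mulf_eq0 negb_or polyC_eq0 => /andP[b0 _].
rewrite rmorphM /= map_polyC rootM rootC fmorph_eq0 (negPf b0)/=.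
by rewrite rootE (negPf gz).
Qed.

Lemma size_drop_coef h n : (size h <= n.+1)%N -> h`_n = 0 -> (size h <= n)%N.
Proof.
move=> hn h0; apply/leq_sizeP => j; rewrite leq_eqVlt => /orP[/eqP <- //|nj].
by rewrite nth_default// (leq_trans hn).
Qed.

(** The zeros of f are real, and simple because f / g increases at them; this
    also gives the sign of the residues of - g / f. At infinity there are three
    cases: a <> 0; a = 0 and b <> 0; a = b = 0, where f / g decays like 1 / X
    with a negative coefficient, so that - g / f has a positive slope. *)
Lemma herglotz_inv f g : f != 0 -> herglotz f g -> herglotz (- g) f.
Proof.
move=> f0 H; have [ps sg [sgn szf slope]] := H; have [g0 _ _] := sg.
have lg0 : lead_coef g != 0 by rewrite lead_coef_eq0.
have pos x : root f x -> 0 < f^`().[x] * g.[x].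
  move=> fx; have := herglotz_deriv_root H fx; have := herglotz_slope_ge0 H.
  have gx : 0 < g.[x] ^+ 2.
    rewrite exprn_even_gt0//=; apply: contraTneq (fx) => gx.
    by apply/negP => /rootP fx0; have := sgn x; rewrite rootE gx fx0 mul0r ltxx
      eqxx => /(_ isT).
  rewrite le0r => /orP[/eqP a0|a0]; last first.
    by case=> le _; apply: lt_le_trans le; rewrite mulr_gt0.
  rewrite a0 mul0r => -[le iff]; rewrite lt_neqAle le iff andbT.
  apply: contraTN fx => /eqP g1.
  have : (size f <= 1)%N.
    apply: size_drop_coef; first by move: szf; rewrite g1.
    by move/eqP: a0; rewrite mulf_eq0 invr_eq0 (negPf lg0) orbF g1 => /eqP.
  by move=> /size1_polyC fc; move: f0; rewrite fc rootC polyC_eq0.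
have [|qs sf] := simple_roots_exist f0 (fun z => herglotz_real_roots H f0).
  by move=> x /pos; apply: contraTneq => ->; rewrite mul0r ltxx.
suff [szg slg] : (size g <= (size f).+1)%N /\ 0 <= - g`_(size f) * lead_coef f.
  exists qs => //; split; rewrite ?size_polyN ?coefN// => p fp.
  by rewrite hornerN mulNr oppr_lt0 mulrC pos.
have [fge|szlt] := leqP (size g) (size f).
  by rewrite leqW// nth_default// oppr0 mul0r.
have szfg : (size f <= (size g).-1)%N by rewrite -ltnS prednK ?size_poly_gt0.
have fn0 : f`_(size g) = 0 by rewrite nth_default// ltnW.
have [b ef] := partial_fractions sg szf.
pose w := \sum_(p <- ps) f.[p] / g^`().[p].
move: ef; rewrite fn0 mul0r scale0r add0r mul_polyC => ef.
have szg0 := size_poly_gt0 g; rewrite g0 in szg0.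
have szs : (size (\sum_(p <- ps) (f.[p] / g^`().[p]) *: cofactor g p)%R
    <= (size g).-1)%N.
  apply: (big_ind (fun h : {poly R} => (size h <= (size g).-1)%N))
    => [|h1 h2 l1 l2|p _].
  - by rewrite size_poly0.
  - by rewrite (leq_trans (size_polyD _ _))// geq_max l1.
  - by rewrite (leq_trans (size_scale_leq _ _))// size_cofactor.
have b0 : b = 0.
  have : f`_(size g).-1 = 0 by rewrite nth_default.
  rewrite {1}ef coefD coefZ [X in _ + X]nth_default// addr0 => /eqP.
  by rewrite mulf_eq0 (negPf lg0) orbF => /eqP.
rewrite b0 scale0r add0r in ef.
have wf : f`_(size g).-2 = w * lead_coef g.
  rewrite {1}ef coef_sum mulr_suml !big_seq; apply: eq_bigr => p pps.
  have gp : root g p by rewrite (simple_roots_root _ sg).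
  by rewrite coefZ -(lead_coef_cofactor gp) lead_coefE size_cofactor.
have w_lt0 : w < 0.
  rewrite /w; case: (ps) sg ef => [|p ps1] sgp efp.
    by move: f0; rewrite efp big_nil eqxx.
  rewrite big_cons big_seq ltr_nwDl//; last first.
    rewrite sumr_le0// => q qs'; apply/ltW/herglotz_residue_lt0 => //.
    by rewrite (simple_roots_root _ sgp) in_cons qs' orbT.
  by apply/herglotz_residue_lt0 => //; rewrite (simple_roots_root _ sgp)
    mem_head.
have wf0 : f`_(size g).-2 != 0 by rewrite wf mulf_neq0// lt_eqF.
have szf' : (size f).+1 = size g.
  have : ((size g).-2 < size f)%N.
    by rewrite ltnNge; apply: contraNN wf0 => ?; rewrite nth_default.
  have : (0 < size f)%N by rewrite size_poly_gt0.
  move: szfg; case: (size g) => [|[|n]] /=; try by rewrite leqn0 => /eqP ->.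
  by move=> le _ lt; apply/eqP; rewrite eqSS eqn_leq le.
split; first by rewrite szf'.
have -> : g`_(size f) = lead_coef g by rewrite lead_coefE -szf'.
have -> : lead_coef f = w * lead_coef g by rewrite -wf lead_coefE -szf'.
by rewrite mulNr mulrCA -mulNr -expr2 mulr_ge0 ?sqr_ge0// oppr_ge0 ltW.
Qed.

End SimpleRealRoots.

(** * String pairs *)

Section StringPairs.
Variable R : rcfType.
Implicit Types (f g A U : {poly R}) (t w v : R).

(** The class depends on the quotient f / g only; used to normalize the signs
    after two inversions. *)
Lemma herglotz_opp f g : herglotz (- f) (- g) -> herglotz f g.
Proof.
move=> [ps [g0 ups eg] [sgn szf slope]]; rewrite oppr_eq0 in g0.
exists ps.
  by split=> //; rewrite -[LHS]opprK {1}eg lead_coefN scaleNr opprK.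
split.
- by move=> p gp; have := sgn p; rewrite rootN derivN !hornerN mulrNN => ->.
- by rewrite !size_polyN in szf.
- by rewrite coefN size_polyN lead_coefN mulrNN in slope.
Qed.

(** The factor kappa = z omega + z^2 v by which a site acts, as a polynomial in
    z. *)
Definition potential w v : {poly R} := (w%:P + v *: 'X) * 'X.

Definition good_potential w v := (0 <= v) && (0 < `|w| + v).

(** What a half-line produces: [A] is the value and [U] the slope at its end
    point of the solution that decays at the far end, as polynomials in z, both
    normalized to be 1 at z = 0. *)
Definition string_pair A U :=
  [/\ A.[0] = 1, U.[0] = 1, (size U <= size A)%N & herglotz (- U) ('X * A)].

Lemma size_affine w v : (size (v *: 'X + w%:P)%R <= 2)%N.
Proof.
rewrite (leq_trans (size_polyD _ _))// geq_max (leq_trans (size_scale_leq _ _))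
  ?size_polyX//.
by rewrite (leq_trans (size_polyC_leq1 _)).
Qed.

Lemma potential0 w v : (potential w v).[0] = 0.
Proof. by rewrite hornerM hornerX mulr0. Qed.

Lemma horner0_neq0 f : f.[0] = 1 -> f != 0.
Proof. by apply: contra_eqN => /eqP ->; rewrite horner0 eq_sym oner_eq0. Qed.

Lemma size_mulXl f : f != 0 -> size ('X * f) = (size f).+1.
Proof. by move=> f0; rewrite mulrC size_mulX. Qed.

Lemma size_potential w v : good_potential w v -> (1 < size (potential w v))%N.
Proof.
move=> /andP[v0 wv]; rewrite /potential size_mulX ?ltnS ?size_poly_gt0//;
  apply/eqP => /polyP e; have := e 0%N; have := e 1%N;
  rewrite !coefD !coefC !coefZ !coefX /= mulr0 mulr1 add0r addr0 => v1 w0;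
  by rewrite v1 w0 normr0 addr0 ltxx in wv.
Qed.

(** One step of the continued fraction. Crossing a site changes the slope by -
    kappa A; then a gap, on which the solution is affine in y = e^{-x}, moves
    the value towards the slope. On Herglotz functions these are the addition of
    a linear function, an inversion, again the addition of a linear function,
    and a second inversion. *)
Lemma string_pair_add_site A U w v t : string_pair A U -> good_potential w v ->
  0 < t < 1 ->
  let U1 := U - potential w v * A in
  let A1 := (1 - t) *: U1 + t *: A in
  [/\ string_pair A1 U1, (size A < size U1)%N, size A1 = size U1 &
      lead_coef A1 = (1 - t) * lead_coef U1].
Proof.
move=> [A0 U0 szU H] wv /andP[t0 t1] U1 A1.
have An0 := horner0_neq0 A0.
have kA : (size A < size (potential w v * A)%R)%N.
  have k1 := size_potential wv.
  have k0 : potential w v != 0 by rewrite -size_poly_gt0 ltnW.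
  rewrite size_mul//.
  by case: (size (potential w v)) k1 => [|[|n]] //= _;
    rewrite !addSn /= ltnS leq_addl.
have szU1 : (size A < size U1)%N.
  by rewrite /U1 addrC size_polyDl size_polyN// (leq_ltn_trans szU).
have U10 : U1.[0] = 1.
  by rewrite hornerD hornerN hornerM potential0 mul0r subr0.
have tA : (size (t *: A) < size ((1 - t) *: U1))%N.
  by rewrite !size_scale ?gt_eqF ?subr_gt0.
have szA1 : size A1 = size U1.
  by rewrite size_polyDl// size_scale// gt_eqF ?subr_gt0.
have A10 : A1.[0] = 1 by rewrite hornerD !hornerZ A0 U10; ring.
have lA1 : lead_coef A1 = (1 - t) * lead_coef U1.
  by rewrite lead_coefDl// lead_coefZ.
(* U1 / (X A) differs from U / (X A) by a linear function, of slope - v *)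
have H1 : herglotz (- U1) ('X * A).
  have -> : - U1 = - U + (w%:P + v *: 'X) * ('X * A).
    by rewrite /U1 /potential mulrA; ring.
  have [_ /andP[v0 _]] := (I, wv).
  apply: herglotz_shift H.
    by rewrite addrC size_affine.
  rewrite mulrDl coefD mul_polyC coefD coefZ -scalerAl coefZ coefXM.
  rewrite size_mulXl//= nth_default ?size_polyN ?leqW// [A`_ _]nth_default//.
  rewrite mulr0 !add0r !coefXM /= size_poly_eq0 (negPf An0) -lead_coefE.
  by rewrite lead_coefM lead_coefX mul1r -mulrA mulr_ge0// -expr2 sqr_ge0.
have U1n0 := horner0_neq0 U10.
have H2 : herglotz ('X * A) U1.
  by apply: herglotz_opp; apply: herglotz_inv; rewrite ?oppr_eq0.
(* X A1 / U1 = t (X A / U1) + (1 - t) X *)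
have H3 : herglotz ('X * A1) U1.
  have -> : 'X * A1 = t *: ('X * A) + ((1 - t) *: 'X) * U1.
    by rewrite /A1 -!mul_polyC; ring.
  apply: herglotz_shift; last exact: herglotz_scale.
    by rewrite (leq_trans (size_scale_leq _ _)) ?size_polyX.
  rewrite -scalerAl coefD !coefZ !coefXM size_poly_eq0 (negPf U1n0).
  rewrite [A`_ _]nth_default ?mulr0 ?add0r;
    last by rewrite -ltnS prednK ?size_poly_gt0.
  by rewrite -lead_coefE -mulrA -expr2 mulr_ge0 ?sqr_ge0 ?subr_ge0 ?ltW.
split=> //; split; rewrite ?szA1//.
by apply: herglotz_inv => //; rewrite mulf_neq0 ?polyX_eq0 ?horner0_neq0.
Qed.

(** The converse step: the limit of A / U at infinity gives the gap, and the
    quotient of the division of U by z A' gives the weights of the site. The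
    subtraction of these terms leaves Herglotz functions, with a smaller degree.
    *)
Lemma string_pair_remove_site A U : string_pair A U -> (1 < size A)%N ->
  exists t w v A1 U1, [/\ 0 < t < 1, good_potential w v, string_pair A1 U1,
    (size A1 < size A)%N & U = U1 - potential w v * A1 /\
    A = (1 - t) *: U + t *: A1].
Proof.
move=> [A0 U0 szU H] A1; have [An0 Un0] := (horner0_neq0 A0, horner0_neq0 U0).
have lA0 : lead_coef A != 0 by rewrite lead_coef_eq0.
have lU0 : lead_coef U != 0 by rewrite lead_coef_eq0.
have XAn0 : 'X * A != 0 by rewrite mulf_neq0 ?polyX_eq0.
have HU : herglotz ('X * A) U.
  by apply: herglotz_opp; apply: herglotz_inv; rewrite ?oppr_eq0.
have szA : size A = size U.
  apply/eqP; rewrite eqn_leq szU andbT -ltnS -size_mulXl//.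
  by have [ps _ []] := HU.
(* the limit of A / U at infinity is the first term 1 - t of the continued
   fraction *)
pose tau := lead_coef A / lead_coef U.
have slopeE : ('X * A)`_(size U) = lead_coef A.
  by rewrite coefXM size_poly_eq0 (negPf Un0) lead_coefE szA.
have tau0 : 0 < tau.
  by have := herglotz_slope_ge0 HU; rewrite slopeE lt_neqAle => ->;
    rewrite andbT
    eq_sym mulf_neq0// invr_eq0.
(* X A / U vanishes at 0 with derivative A(0) / U(0) = 1, while the slope of a
   Herglotz function bounds its derivative at a zero from below *)
have tau1 : tau < 1.
  have X0 : root ('X * A) 0 by rewrite rootM rootX eqxx.
  have := herglotz_deriv_root HU X0.
  rewrite slopeE U0 derivM derivX mul1r hornerD hornerM hornerX mul0r addr0 A0.
  rewrite expr1n !mulr1 -/tau => -[le1 iff].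
  by rewrite lt_neqAle le1 iff -szA gtn_eqF.
pose t := 1 - tau; have t0 : 0 < t by rewrite subr_gt0.
have tn0 : t != 0 by rewrite gt_eqF.
pose A' := t^-1 *: (A - tau *: U).
have AE : A = (1 - t) *: U + t *: A'.
  have -> : 1 - t = tau by rewrite /t; ring.
  by rewrite /A' scalerA divff// scale1r addrC subrK.
have A'0 : A'.[0] = 1.
  by rewrite hornerZ hornerD hornerN hornerZ A0 U0 mulr1 mulVf.
have A'n0 := horner0_neq0 A'0.
have szA' : (size A' < size A)%N.
  have szA0 : (0 < size A)%N by rewrite ltnW.
  rewrite /A' size_scale ?invr_eq0// -[leqRHS](prednK szA0) ltnS.
  apply: size_drop_coef.
    by rewrite prednK// (leq_trans (size_polyD _ _))// size_polyN geq_max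
      leqnn/= szA size_scale_leq.
  by rewrite coefD coefN coefZ -lead_coefE szA -lead_coefE divfK// subrr.
have H1 : herglotz ('X * A') U.
  have -> : 'X * A' = t^-1 *: ('X * A + (- tau *: 'X) * U).
    by rewrite /A' -!mul_polyC polyCN; ring.
  apply: herglotz_scale; first by rewrite invr_gt0.
  apply: herglotz_shift HU.
    by rewrite (leq_trans (size_scale_leq _ _)) ?size_polyX.
  rewrite coefD slopeE -scalerAl coefZ coefXM size_poly_eq0 (negPf Un0).
  by rewrite -lead_coefE mulNr divfK// subrr mul0r.
have XA'n0 : 'X * A' != 0 by rewrite mulf_neq0 ?polyX_eq0.
have H2 := herglotz_inv XA'n0 H1.
have szNU : (size (- U) <= (size ('X * A')%R).+1)%N by have [ps _ []] := H2.
(* the polynomial part of - U / (X A') is omega + v X *)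
pose Q := (- U) %/ ('X * A'); pose U' := - ((- U) %% ('X * A')).
have szQ : (size Q <= 2)%N by apply: size_divp_le2.
have QE := size2_polyE szQ.
have UE : U = U' - potential Q`_0 Q`_1 * A'.
  rewrite /potential [_ + _ *: _]addrC -QE /U' -opprD addrC -mulrA -divp_eq.
  by rewrite opprK.
have szU' : (size U' <= size A')%N.
  by rewrite -ltnS -(size_mulXl A'n0) /U' size_polyN ltn_modp.
exists t, Q`_0, Q`_1, A', U'; split=> //.
- by rewrite t0 gtrBl.
- apply/andP; split; first by rewrite coef1_divp// herglotz_slope_ge0.
  have v0 : 0 <= Q`_1 by rewrite coef1_divp// herglotz_slope_ge0.
  rewrite lt_neqAle addr_ge0// andbT eq_sym paddr_eq0// normr_eq0.
  apply/negP => /andP[/eqP w0 /eqP v00].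
  have Q0 : Q = 0 by rewrite QE w0 v00 scale0r addr0.
  have : (size U < size U)%N.
    rewrite {1}UE w0 v00 /potential scale0r addr0 !mul0r subr0
      (leq_ltn_trans szU')//.
    by rewrite -szA.
  by rewrite ltnn.
- split=> //.
    by have := U0; rewrite {1}UE hornerD (hornerN (_ * A')) hornerM potential0
      mul0r subr0.
  have -> : - U' = - U + (- Q) * ('X * A').
    by rewrite mulNr {1}(divp_eq (- U) ('X * A')) addrAC subrr add0r /U' opprK.
  apply: herglotz_shift H2; first by rewrite size_polyN.
  rewrite mulNr {1}(divp_eq (- U) ('X * A')) addrAC subrr add0r nth_default
    ?mul0r//.
  by rewrite ltnW// ltn_modp.
Qed.

End StringPairs.

(** * Propagation through the sites and the half-line inverse problem *)

Section States.
Variable R : realType.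
Implicit Types (s : R * R * R) (p q : pair_data R) (a x : R).
Implicit Types (X : {poly R} * {poly R}).

(** Crossing the site [s] from right to left, for a solution written as c.1
    e^{-x/2} + c.2 e^{x/2}: it is continuous and its derivative jumps by kappa
    times its value. The ring is a parameter because z is an indeterminate in
    the algebraic part and a complex number in the analytic part. *)
Definition cross (T : comNzRingType) (iota : R -> T) (z : T) s (c : T * T) :
  T * T :=
  let g := c.1 + iota (expR (site s)) * c.2 in
  let k := (iota (omega_at s) + iota (v_at s) * z) * z in
  (c.1 - k * g, c.2 + k * iota (expR (- site s)) * g).

Definition pcross s X := cross (@polyC R) 'X s X.
Definition transfer p X := foldr pcross X p.
(** The coefficients of phi_+ to the left of all the sites of [p]. *)
Definition pstate p : {poly R} * {poly R} := transfer p (1, 0).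

(** For the sites of a half-line: the derivative at its end point of e^{-x/2}
    phi_+ in the coordinate y = e^{-x}. For a whole pair, this coefficient of
    e^{-x/2} to the left of all sites is the Wronskian of phi_+ and phi_-. *)
Definition slope p : {poly R} := (pstate p).1.
(** The polynomial e^{a/2} phi_+(z, a), if all the sites of [p] are to the right
    of a. *)
Definition value a p : {poly R} := (pstate p).1 + (expR a)%:P * (pstate p).2.

Definition good_site s := good_potential (omega_at s) (v_at s).
Definition halfline a p := path <%R a [seq site s | s <- p] && all good_site p.
Definition site_potential s := potential (omega_at s) (v_at s).

Lemma slope_cons s p : slope (s :: p) = slope p -
  site_potential s * value (site s) p.
Proof.
rewrite /slope -[pstate (s :: p)]/(pcross s (pstate p)) /pcross /cross /=.
by rewrite /value /site_potential /potential -mul_polyC.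
Qed.

(** In the coordinate y = e^{-x} the solution e^{-x/2} phi_+ is affine between a
    and the first site, and e^{a - site s} is the ratio of the coordinates of
    these points. *)
Lemma value_cons a s p :
  value a (s :: p) = (1 - expR (a - site s)) *: slope (s :: p)
                     + expR (a - site s) *: value (site s) p.
Proof.
rewrite {1}/value -/(slope (s :: p)); set t := expR (a - site s).
have -> : expR a = t * expR (site s) by rewrite /t -expRD subrK.
have e1 : (expR (site s))%:P * (expR (- site s))%:P = 1 :> {poly R}.
  by rewrite -polyCM -expRD subrr expR0.
rewrite slope_cons /site_potential /potential /value /slope.
rewrite -[pstate (s :: p)]/(pcross s (pstate p)) /pcross /cross /=.
case: (pstate p) => u w /=; rewrite -!mul_polyC polyCM polyCB polyC1.
set E := (expR (site s))%:P in e1 *; set E' := (expR (- site s))%:P in e1 *.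
have -> : t%:P * E * (w + ((omega_at s)%:P + (v_at s)%:P * 'X) * 'X * E' * (u +
  E * w))
  = t%:P * (E * w + ((omega_at s)%:P + (v_at s)%:P * 'X) * 'X * (E * E') *
    (u + E * w)) by ring.
by rewrite e1; ring.
Qed.

Lemma slope0 p : (slope p).[0] = 1.
Proof.
elim: p => [|s p IH]; first by rewrite /slope /= hornerE.
by rewrite slope_cons hornerD hornerN hornerM potential0 mul0r subr0.
Qed.

Lemma value_nil a : value a [::] = 1.
Proof. by rewrite /value /= mulr0 addr0. Qed.

Lemma value0 a p : (value a p).[0] = 1.
Proof.
elim: p a => [|s p IH] a; first by rewrite value_nil hornerE.
by rewrite value_cons hornerD !hornerZ IH slope0 !mulr1 subrK.
Qed.

Lemma string_pair_trivial : string_pair (1 : {poly R}) 1.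
Proof.
split; rewrite ?hornerE// ?mulr1; exists [:: 0].
  by split; rewrite ?polyX_eq0// lead_coefX scale1r big_seq1 subr0.
split=> [x||].
- by rewrite rootX => /eqP ->; rewrite derivX !hornerE.
- by rewrite size_polyN size_poly1.
- by rewrite nth_default ?mul0r// size_polyN size_poly1 size_polyX.
Qed.

Lemma expR_in01 a x : a < x -> 0 < expR (a - x) < 1.
Proof. by move=> ax; rewrite expR_gt0 expR_lt1 subr_lt0. Qed.

Lemma halfline_cons a s p : halfline a (s :: p) =
  [&& a < site s, good_site s & halfline (site s) p].
Proof. by rewrite /halfline /= -andbA [path _ _ _ && (_ && _)]andbCA. Qed.

Lemma halfline_string_pair a p : halfline a p ->
  string_pair (value a p) (slope p).
Proof.
elim: p a => [|s p IH] a; first by rewrite value_nil; move=> _;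
  exact: string_pair_trivial.
rewrite halfline_cons => /and3P[asx gs /IH H].
have [+ _ _ _] := string_pair_add_site H gs (expR_in01 asx).
by rewrite -/(site_potential s) -slope_cons -value_cons.
Qed.

Lemma halfline_cons_lead a s p : halfline a (s :: p) ->
  [/\ (size (value (site s) p) < size (slope (s :: p)))%N,
      size (value a (s :: p)) = size (slope (s :: p)) &
      lead_coef (value a (s :: p)) =
      (1 - expR (a - site s)) * lead_coef (slope (s :: p))].
Proof.
rewrite halfline_cons => /and3P[asx gs /halfline_string_pair H].
have [_ + + +] := string_pair_add_site H gs (expR_in01 asx).
by rewrite -/(site_potential s) -slope_cons -value_cons.
Qed.

Lemma halfline_lead a p : halfline a p ->
  size (value a p) = size (slope p) /\
  exists2 tau, 0 < tau <= 1 & lead_coef (value a p) = tau * lead_coef (slope p).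
Proof.
case: p => [|s p] hp.
  by rewrite value_nil; split=> //; exists 1; rewrite ?ltr01 ?lexx// mul1r.
have [_ -> ->] := halfline_cons_lead hp; split=> //.
exists (1 - expR (a - site s)) => //.
move: hp; rewrite halfline_cons => /andP[/expR_in01/andP[e0 e1] _].
by rewrite subr_gt0 e1 gerBl ltW.
Qed.

Lemma site_ext s t : site s = site t -> omega_at s = omega_at t ->
  v_at s = v_at t -> s = t.
Proof. by case: s t => [[x w] v] [[x' w'] v']; rewrite /site /omega_at /v_at /=
  => -> -> ->. Qed.

(** The continued fraction is unique. The leading coefficients give the first
    gap; kappa is then determined because two candidates differ by a constant
    and vanish at 0. *)
Lemma halfline_inj a p q : halfline a p -> halfline a q ->
  value a p = value a q -> slope p = slope q -> p = q.
Proof.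
have aux b (r : pair_data R) s : halfline b (s :: r) -> slope (s :: r) <> 1.
  move=> /halfline_cons_lead[szlt _ _] e1; move: szlt;
    rewrite e1 size_poly1 ltnS leqn0.
  by rewrite size_poly_eq0 (negPf (horner0_neq0 (value0 _ _))).
elim: p a q => [|s p IH] a [|s' q] //.
- by move=> _ /aux h _ /esym/h.
- by move=> /aux h _ _ /h.
move=> hp hq eA eU.
have [lt1 _ l1] := halfline_cons_lead hp; have [lt2 _ l2] :=
  halfline_cons_lead hq.
have U0 : lead_coef (slope (s' :: q)) != 0.
  by rewrite lead_coef_eq0 horner0_neq0// slope0.
(* the first gap is read off from the leading coefficients *)
have et : expR (a - site s) = expR (a - site s').
  apply: oppr_inj; apply: (addrI 1); apply: (mulIf U0).
  by rewrite -l2 -eA l1 eU.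
have es : site s = site s' by apply: oppr_inj; apply: (addrI a);
  apply: expR_inj.
have t0 : expR (a - site s') != 0 by rewrite gt_eqF ?expR_gt0.
have eA' : value (site s) p = value (site s') q.
  apply: (scalerI t0); move: eA; rewrite !value_cons et eU.
  by move/addrI.
move: hp hq; rewrite !halfline_cons => /and3P[_ _ hp] /and3P[_ _ hq].
have [szp _] := halfline_lead hp; have [szq _] := halfline_lead hq.
have A0 : value (site s') q != 0 by rewrite horner0_neq0// value0.
pose D := site_potential s - site_potential s'.
have eD : D * value (site s') q = slope p - slope q.
  move: eU; rewrite !slope_cons eA' /D mulrBl => /(canRL (subrK _)) ->.
  by rewrite addrAC; ring.
(* the product of D with the common value does not exceed it in degree, so D is
   a constant *)
have szD : (size D <= 1)%N.
  have [->|D0] := eqVneq D 0; first by rewrite size_poly0.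
  have : (size (D * value (site s') q)%R <= size (value (site s') q))%N.
    by rewrite eD (leq_trans (size_polyD _ _))// size_polyN geq_max -szp eA'
      -szq leqnn.
  rewrite size_mul//; case: (size D) => [|[|n]] //.
  by rewrite !addSn /= -ltnS ltnNge addnC leq_addr.
have DE : D = (omega_at s - omega_at s') *: 'X + (v_at s - v_at s') *: 'X^2.
  by rewrite /D /site_potential /potential -!mul_polyC !polyCB; ring.
have ew : omega_at s = omega_at s'.
  apply/eqP; rewrite -subr_eq0; have := leq_sizeP _ _ szD 1%N isT.
  by rewrite DE coefD !coefZ coefX coefXn /= mulr0 addr0 mulr1 => /eqP.
have ev : v_at s = v_at s'.
  apply/eqP; rewrite -subr_eq0; have := leq_sizeP _ _ szD 2%N isT.
  by rewrite DE coefD !coefZ coefX coefXn /= mulr0 add0r mulr1 => /eqP.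
rewrite (site_ext es ew ev).
congr (_ :: _); apply: (IH (site s)); rewrite ?es//; first by rewrite -es.
  by rewrite -{1}es eA'.
apply/eqP; rewrite -subr_eq0 -eD.
by rewrite DE ew ev !subrr !scale0r addr0 mul0r.
Qed.

(** Sites are removed one at a time until the degree is 0. *)
Lemma halfline_surj (A U : {poly R}) a : string_pair A U ->
  exists2 p, halfline a p & value a p = A /\ slope p = U.
Proof.
have [n] := ubnP (size A); elim: n A U a => // n IH A U a;
  rewrite ltnS => szn H.
have [A1|A1] := leqP (size A) 1.
  exists [::] => //; rewrite value_nil; have [A0 U0 szU _] := H.
  have [-> ->] : A = 1 /\ U = 1; last by [].
  by split; rewrite [LHS]size1_polyC ?(leq_trans szU)// -?horner_coef0 ?A0 ?U0.
have [t [w [v [A' [U' [/andP[t0 t1] gwv H' szA' [UE AE]]]]]]] :=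
  string_pair_remove_site H A1.
pose x := a - ln t; have tE : expR (a - x) =
  t by rewrite /x opprB addrCA subrr addr0 lnK.
have [p hp [Ap Up]] := IH A' U' x (leq_trans szA' szn) H'.
have slE : slope ((x, w, v) :: p) = U by rewrite slope_cons Up UE -Ap.
exists ((x, w, v) :: p).
  rewrite halfline_cons hp [good_site _]gwv !andbT /site /= /x ltrDl oppr_gt0.
  by rewrite ln_lt0// t0.
by rewrite value_cons slE tE AE Ap.
Qed.

End States.

(** * Splitting the sites at a point *)

Section Decomposition.
Variable R : realType.
Implicit Types (s : R * R * R) (p q l r c : pair_data R) (a x : R).
Implicit Types (X Y : {poly R} * {poly R}).

(** The Wronskian of two solutions in terms of their coefficients. *)
Definition bracket X Y := X.1 * Y.2 - X.2 * Y.1.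
Definition reflect_site s : R * R * R := (- site s, omega_at s, v_at s).
(** The reflection x -> - x exchanges phi_+ and phi_-, so that the left
    half-line is treated as a right one. *)
Definition reflect p : pair_data R := rev [seq reflect_site s | s <- p].

Lemma expRN_mul x : (expR x)%:P * (expR (- x))%:P = 1 :> {poly R}.
Proof. by rewrite -polyCM -expRD subrr expR0. Qed.

Lemma bracket_cross s X Y : bracket (pcross s X) (pcross s Y) = bracket X Y.
Proof.
have e1 := expRN_mul (site s); move: X Y => [u w] [u' w'].
rewrite /pcross /cross /bracket /=.
set k := _ * 'X; set e := (expR (site s))%:P in e1 *.
set e' := (expR (- site s))%:P in e1 *.
have -> : (u - k * (u + e * w)) * (w' + k * e' * (u' + e * w')) -
  (w + k * e' * (u + e * w)) * (u' - k * (u' + e * w')) =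
  u * w' - w * u' + k * (1 - e * e') * (w * u' - w' * u) by ring.
by rewrite e1 subrr mulr0 mul0r addr0.
Qed.

Lemma bracket_transfer p X Y :
  bracket (transfer p X) (transfer p Y) = bracket X Y.
Proof. by elim: p => //= s p IH; rewrite bracket_cross. Qed.

Lemma reflect_rcons p s : reflect (rcons p s) = reflect_site s :: reflect p.
Proof. by rewrite /reflect map_rcons rev_rcons. Qed.

Lemma reflectK : involutive reflect.
Proof.
move=> p; rewrite /reflect map_rev revK -map_comp -[RHS]map_id.
by apply: eq_map => -[[x w] v]; rewrite /reflect_site /site /= opprK.
Qed.

(** The state of phi_- on the right of [p], which is read off from the reflected
    list with its two coefficients exchanged, is carried to e^{x/2}. *)
Lemma transfer_reflect p :
  transfer p ((pstate (reflect p)).2, (pstate (reflect p)).1) = (0, 1).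
Proof.
elim/last_ind: p => [//|p s IH]; rewrite reflect_rcons /transfer foldr_rcons.
rewrite -[pstate (_ :: _)]/(pcross (reflect_site s) (pstate (reflect p))).
rewrite -[RHS]IH /transfer; congr (foldr _ _ _).
have e1 := expRN_mul (site s); move: (pstate (reflect p)) => [y1 y2].
rewrite /pcross /cross /= /site /omega_at /v_at /= opprK -/(site s).
set k := _ * 'X; set e := (expR (site s))%:P in e1 *.
set e' := (expR (- site s))%:P in e1 *.
have -> : y2 + k * e * (y1 + e' * y2) + e * (y1 - k * (y1 + e' * y2)) = y2 +
  e * y1.
  by ring.
have e2 : e * (y1 + e' * y2) = y2 + e * y1.
  by rewrite mulrDr mulrA e1 mul1r addrC.
congr (_, _); first by rewrite -mulrA e2 addrK.
by rewrite -e2 mulrA -[_ * e' * e]mulrA [e' * e]mulrC e1 mulr1 subrK.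
Qed.

Lemma pstate_cat p q : pstate (p ++ q) = transfer p (pstate q).
Proof. by rewrite /pstate /transfer foldr_cat. Qed.

(** The Wronskian with phi_-, evaluated on either side of [p]. *)
Lemma transfer_slope p X :
  (transfer p X).1 =
  X.1 * (pstate (reflect p)).1 - X.2 * (pstate (reflect p)).2.
Proof.
have := bracket_transfer p X ((pstate (reflect p)).2, (pstate (reflect p)).1).
by rewrite transfer_reflect /bracket /= mulr1 mulr0 subr0.
Qed.

Definition right_part a p : pair_data R := [seq s <- p | a < site s].
Definition center_part a p : pair_data R := [seq s <- p | site s == a].
Definition left_part a p : pair_data R := reflect [seq s <- p | site s < a].

Definition right_value a p := value a (right_part a p).
Definition right_slope a p := slope (right_part a p).
Definition left_value a p := value (- a) (left_part a p).
Definition left_slope a p := slope (left_part a p).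
Definition center_potential a p := \sum_(s <- center_part a p) site_potential s.

Definition sites_sorted p := sorted <%R [seq site s | s <- p].

Lemma sorted_filter_map (P : pred (R * R * R)) p :
  sites_sorted p -> sites_sorted [seq s <- p | P s].
Proof.
by rewrite /sites_sorted !sorted_map; apply: sorted_filter => x y z /=;
  exact: lt_trans.
Qed.

Lemma sorted_split a p : sites_sorted p ->
  p = [seq s <- p | site s < a] ++ center_part a p ++ right_part a p.
Proof.
rewrite /center_part /right_part /sites_sorted; elim: p => //= s p IH sp.
have sp' := path_sorted sp; have lts : all (fun t => site s < site t) p.
  by have := order_path_min lt_trans sp; rewrite all_map.
have none (P : pred (R * R * R)) : (forall t, site s < site t -> ~~ P t) ->
  [seq t <- p | P t] = [::].
  move=> h; apply/eqP; rewrite -[_ == _]negbK -has_filter -all_predC.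
  by apply: sub_all lts => t /h.
case: (ltrgtP (site s) a) => [lt|gt|eq] /=; first by congr (_ :: _); apply: IH.
  rewrite {1}IH// !(none (fun t => site t < a))
    ?(none (fun t => site t == a))//=.
    by move=> t st; rewrite gt_eqF// (lt_trans gt).
  by move=> t st; rewrite -leNgt ltW// (lt_trans gt).
rewrite {1}IH// !(none (fun t => site t < a)) ?(none (fun t => site t == a))//=.
  by move=> t; rewrite eq => st; rewrite gt_eqF.
by move=> t; rewrite eq => st; rewrite -leNgt ltW.
Qed.

Lemma center_cases a p : sites_sorted p ->
  center_part a p = [::] \/ exists2 s, center_part a p = [:: s] & site s = a.
Proof.
move=> sp; have := sorted_filter_map (fun s => site s == a) sp.
have : all (fun s => site s == a) (center_part a p) by rewrite filter_all.
rewrite /sites_sorted -/(center_part a p).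
case: (center_part a p) => [|s [|t c]] /=; [by left|by move=> /andP[/eqP ? _];
  right; exists s|].
by move=> /and3P[/eqP -> /eqP ->]; rewrite ltxx.
Qed.

(** The state of phi_+ immediately to the left of the point [a]. *)
Definition state_before a p :=
  transfer (center_part a p) (pstate (right_part a p)).

Lemma state_before_value a p : sites_sorted p ->
  (state_before a p).1 + (expR a)%:P * (state_before a p).2 = right_value a p.
Proof.
rewrite /state_before /right_value /value => /(center_cases a)[->//|[s -> sa]].
have := expRN_mul a.
rewrite /= /pcross /cross sa; case: (pstate _) => u w /=.
set k := _ * 'X; set e := (expR a)%:P; set e' := (expR (- a))%:P => e1.
have -> : u - k * (u + e * w) + e * (w + k * e' * (u + e * w))
  = u + e * w + k * (e * e' - 1) * (u + e * w) by ring.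
by rewrite e1 subrr mulr0 mul0r addr0.
Qed.

(** The Wronskian of phi_+ and phi_- evaluated at the point a. *)
Lemma slope_split a p : sites_sorted p ->
  slope p = right_slope a p * left_value a p + right_value a p * left_slope a p
            - (1 + center_potential a p) * (right_value a p * left_value a p).
Proof.
move=> sp; rewrite {1}(sorted_split a sp) /slope pstate_cat transfer_slope
  pstate_cat.
rewrite /right_slope /left_value /right_value /left_slope /center_potential.
rewrite -/(left_part a p) /value /slope.
have := expRN_mul a; case: (pstate (left_part a p)) => l1 l2 /=.
set e := (expR a)%:P; set e' := (expR (- a))%:P => e1.
case: (center_cases a sp) => [->|[s -> sa]].
  rewrite big_nil addr0 /=; case: (pstate (right_part a p)) => r1 r2 /=.
  have -> : r1 * (l1 + e' * l2) + (r1 + e * r2) * l1 -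
    1 * ((r1 + e * r2) * (l1 + e' * l2))
    = r1 * l1 - (e * e') * r2 * l2 by ring.
  by rewrite e1 mul1r.
rewrite big_seq1 /= /pcross /cross sa -/e -/e' /site_potential /potential
  -mul_polyC.
case: (pstate (right_part a p)) => r1 r2 /=; set k := _ * 'X.
have -> : r1 * (l1 + e' * l2) + (r1 + e * r2) * l1 -
  (1 + k) * ((r1 + e * r2) * (l1 + e' * l2))
  = r1 * l1 - (e * e') * r2 * l2 - k * ((r1 + e * r2) * (l1 + e' * l2)) by ring.
by rewrite e1; ring.
Qed.

End Decomposition.

(** * The Lagrange identity *)

Section Energy.
Variable R : realType.
Implicit Types (s : R * R * R) (p q l r c : pair_data R) (a x : R).

Lemma right_part_mem s t p : sites_sorted (s :: p) -> t \in p ->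
  right_part (site t) (s :: p) = right_part (site t) p.
Proof.
move=> sp tp; rewrite /right_part /= ltNge; have := order_path_min lt_trans sp.
by rewrite all_map => /allP /(_ _ tp) /= /ltW ->.
Qed.

Lemma right_part_head s p : sites_sorted (s :: p) ->
  right_part (site s) (s :: p) = p.
Proof.
move=> sp; rewrite /right_part /= ltxx; apply/all_filterP.
by have := order_path_min lt_trans sp; rewrite all_map.
Qed.

(** The Wronskian of phi_+ with its derivative in z, to the left of all sites.
    *)
Definition energy p : {poly R} :=
  (pstate p).1 * (pstate p).2^`() - (pstate p).2 * (pstate p).1^`().

(** Lagrange identity: each site adds kappa' phi_+^2 to the Wronskian of phi_+
    and its z-derivative. The right-hand side is gamma^2 when z is an
    eigenvalue. *)
Lemma energy_sum p : sites_sorted p ->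
  energy p = \sum_(s <- p) ((omega_at s)%:P + (v_at s *+ 2) *: 'X) *
     ((expR (- site s))%:P * right_value (site s) p ^+ 2).
Proof.
elim: p => [|s p IH] sp.
  by rewrite /energy big_nil /= derivC mulr0 derivC !mul0r subr0.
rewrite big_cons /right_value right_part_head// /energy.
have -> : \sum_(t <- p) ((omega_at t)%:P + (v_at t *+ 2) *: 'X) *
    ((expR (- site t))%:P * value (site t) (right_part (site t) (s :: p)) ^+ 2)
    = energy p.
  rewrite (IH (path_sorted sp)) !big_seq; apply: eq_bigr => t tp.
  by rewrite /right_value right_part_mem.
rewrite /energy /value -[pstate (s :: p)]/(pcross s (pstate p)) /pcross /cross.
have := expRN_mul (site s); case: (pstate p) => u w /=.
set e := (expR (site s))%:P; set e' := (expR (- site s))%:P => e1.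
set k := (_ + _) * 'X; have dk : k^`() = (omega_at s)%:P + (v_at s *+ 2) *: 'X.
  rewrite /k derivM derivX mulr1 derivD derivM !derivC mul0r !add0r derivX
    mulr1.
  by rewrite mulr2n scalerDl mul_polyC addrCA.
have de : e^`() = 0 by rewrite derivC.
have de' : e'^`() = 0 by rewrite derivC.
clearbody k e e'.
rewrite !(derivB, derivD, derivM) de de' dk !mulr0 !mul0r !(add0r, addr0).
set dk' := _ + _ *: 'X; set u' := u^`(); set w' := w^`().
have -> : (u - k * (u + e * w)) * (w' + (dk' * e' * (u + e * w) +
  k * e' * (u' + e * w')))
  - (w + k * e' * (u + e * w)) *
    (u' - (dk' * (u + e * w) + k * (u' + e * w'))) =
  dk' * (e' * (u + e * w) ^+ 2) + (u * w' - w * u')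
  + (1 - e * e') * (dk' * (u + e * w) * w
                    + k * ((u' + e * w') * w - (u + e * w) * w')) by ring.
by rewrite e1 subrr mul0r addr0.
Qed.

(** At a root of the Wronskian phi_+ is a multiple of phi_-; the factor is its
    coefficient to the left of all sites. *)
Lemma right_value_at_root a p x : sites_sorted p -> root (slope p) x ->
  (right_value a p).[x] ^+ 2 * expR (- a) =
  (pstate p).2.[x] * ((right_value a p).[x] * (left_value a p).[x]).
Proof.
move=> sp /rootP px.
set w := (pstate p).2.[x]; set l0 := [seq s <- p | site s < a].
have stE : pstate p = transfer l0 (state_before a p).
  by rewrite {1}(sorted_split a sp) !pstate_cat.
(* the bracket with an arbitrary Y is propagated to the left of all sites, where
   phi_+ is (0, w) and phi_- is (0, 1) *)
have step Y : (state_before a p).1.[x] * Y.2.[x] -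
  (state_before a p).2.[x] * Y.1.[x]
    = w * ((pstate (left_part a p)).2.[x] * Y.2.[x] -
      (pstate (left_part a p)).1.[x] * Y.1.[x]).
  have b1 := bracket_transfer l0 (state_before a p) Y.
  have b2 := bracket_transfer l0 ((pstate (left_part a p)).2,
    (pstate (left_part a p)).1) Y.
  rewrite transfer_reflect -stE in b1 b2.
  have := congr1 (horner^~ x) b1; have := congr1 (horner^~ x) b2.
  rewrite /bracket !(hornerE, hornerM) /= -/(slope p) px -/w ?mul0r ?sub0r
    ?mul1r => <- <-.
  by rewrite mulrN.
have e1 := step (0, 1); have e2 := step (1, 0).
rewrite /= !hornerE !(mulr1, mulr0, subr0, sub0r) in e1 e2.
have e2' : (state_before a p).2.[x] = w * (pstate (left_part a p)).1.[x].
  by apply: oppr_inj; rewrite e2 mulrN.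
rewrite -(state_before_value a sp) /left_value /value !hornerE e1 e2'.
have : expR a * expR (- a) = 1 by rewrite -expRD subrr expR0.
set e := expR a; set e' := expR (- a); set l1 := (_ .1.[x]);
  set l2 := (_.2.[x]) => ee.
have -> : (w * l2 + e * (w * l1)) ^+ 2 * e' = 
  w * ((w * l2 + e * (w * l1)) * ((e * e') * l1 + e' * l2)) by ring.
by rewrite ee mul1r; exact: mulrA.
Qed.

Lemma pstate2_at_root p x : root (slope p) x -> (pstate p).2.[x] != 0.
Proof.
move=> /rootP px; apply/negP => /eqP w0.
have b1 : bracket (pstate p) (transfer p (0, 1)) = 1.
  by rewrite -[pstate p]/(transfer p (1, 0)) bracket_transfer /bracket /= mulr1
    mulr0 subr0.
have := congr1 (horner^~ x) b1; rewrite /bracket /= hornerD hornerN !hornerM.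
by rewrite -/(slope p) px w0 !mul0r subrr hornerC => /eqP;
  rewrite eq_sym oner_eq0.
Qed.

Lemma energy_at_root p x : root (slope p) x ->
  (energy p).[x] = - ((pstate p).2.[x] * (slope p)^`().[x]).
Proof.
by move=> /rootP px; rewrite /energy -/(slope p) !hornerE px mul0r sub0r.
Qed.

End Energy.

(** * The numerator of the Green function *)

Section Parts.
Variable R : realType.
Implicit Types (s : R * R * R) (p q l r c : pair_data R) (a x : R).

(** A pair that may be empty: the construction below has to be shown afterwards
    to produce at least one site. *)
Definition weak_pair p := sites_sorted p && all (@good_site R) p.

Lemma halflineE a p : halfline a p = all (fun s => a < site s) p && weak_pair p.
Proof. by rewrite /halfline (path_sortedE lt_trans) all_map andbA. Qed.

Lemma sites_sorted_reflect p : sites_sorted (reflect p) = sites_sorted p.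
Proof.
rewrite /sites_sorted /reflect map_rev rev_sorted -map_comp !sorted_map.
by apply: eq_sorted => s t /=; rewrite /site /= ltrN2.
Qed.

Lemma all_reflect (P : pred (R * R * R)) p :
  all P (reflect p) = all (fun s => P (reflect_site s)) p.
Proof. by rewrite /reflect all_rev all_map. Qed.

Lemma weak_pair_reflect p : weak_pair (reflect p) = weak_pair p.
Proof.
by rewrite /weak_pair sites_sorted_reflect all_reflect; congr (_ && _);
  apply: eq_all.
Qed.

Lemma weak_pair_filter (P : pred (R * R * R)) p : weak_pair p ->
  weak_pair [seq s <- p | P s].
Proof.
move=> /andP[sp gp]; apply/andP; split; first exact: sorted_filter_map.
by apply/allP => s; rewrite mem_filter => /andP[_ /(allP gp)].
Qed.

Lemma halfline_right a p : weak_pair p -> halfline a (right_part a p).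
Proof. by move=> wp; rewrite halflineE filter_all weak_pair_filter. Qed.

Lemma halfline_left a p : weak_pair p -> halfline (- a) (left_part a p).
Proof.
move=> wp; rewrite halflineE weak_pair_reflect weak_pair_filter// andbT
  all_reflect.
by apply/allP => s; rewrite mem_filter /site /= ltrN2 => /andP[].
Qed.

Definition assemble l c r : pair_data R := reflect l ++ c ++ r.

Lemma filter_none (P : pred (R * R * R)) p : all (predC P) p ->
  [seq s <- p | P s] = [::].
Proof. by rewrite all_predC => /negPf nP; apply/eqP;
  rewrite -[_ == _]negbK -has_filter nP. Qed.

Lemma filter_full (P : pred (R * R * R)) p : all P p -> [seq s <- p | P s] = p.
Proof. by move/all_filterP. Qed.

Lemma assembleP a l c r : halfline (- a) l -> halfline a r -> weak_pair c ->
  all (fun s => site s == a) c ->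
  [/\ weak_pair (assemble l c r), left_part a (assemble l c r) = l,
      center_part a (assemble l c r) = c & right_part a (assemble l c r) = r].
Proof.
rewrite !halflineE => /andP[la wl] /andP[ra wr] wc ca.
have la' : all (fun s => site s < a) (reflect l).
  by rewrite all_reflect; apply: sub_all la => s; rewrite /site /= ltrNl.
split.
- move: wl wr wc; rewrite -(weak_pair_reflect l) => /andP[sl gl] /andP[sr gr]
  /andP[sc gc].
  rewrite /weak_pair /assemble !all_cat gl gc gr !andbT /sites_sorted !map_cat.
  rewrite !sorted_pairwise; try exact: lt_trans.
  rewrite !pairwise_cat -!sorted_pairwise; try exact: lt_trans.
  rewrite -!/(sites_sorted _) sl sc sr !andbT /=; apply/andP; split;
    apply/allrelP => x y.
    move=> /mapP[s /(allP la') sa ->]; rewrite mem_cat => /orP[] /mapP[t].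
      by move=> /(allP ca)/eqP + -> => ->.
    by move=> /(allP ra) ta ->; apply: lt_trans ta.
  by move=> /mapP[s /(allP ca)/eqP sa ->] /mapP[t /(allP ra) ta ->]; rewrite sa.
- rewrite /left_part /assemble !filter_cat filter_full// !filter_none ?cats0
  ?reflectK//.
    by apply: sub_all ra => s /= ta; rewrite -leNgt ltW.
  by apply: sub_all ca => s /= /eqP ->; rewrite ltxx.
- rewrite /center_part /assemble !filter_cat (filter_full ca) !filter_none
  ?cats0//.
    by apply: sub_all ra => s /= ta; rewrite gt_eqF.
  by apply: sub_all la' => s /= ta; rewrite lt_eqF.
- rewrite /right_part /assemble !filter_cat (filter_full ra) !filter_none//.
    by apply: sub_all ca => s /= /eqP ->; rewrite ltxx.
  by apply: sub_all la' => s /= ta; rewrite -leNgt ltW.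
Qed.

Lemma weak_pair_assemble a p : weak_pair p ->
  p = assemble (left_part a p) (center_part a p) (right_part a p).
Proof. by move=> /andP[sp _]; rewrite /assemble /left_part reflectK
  -sorted_split. Qed.

(** At most one site is at [a], and it carries a nonzero potential. *)
Lemma center_potential_inj a p q : weak_pair p -> weak_pair q ->
  center_potential a p = center_potential a q -> center_part a p = center_part a
    q.
Proof.
have ch0 s : good_site s -> site_potential s != 0.
  by move=> /size_potential sz; rewrite -size_poly_gt0 ltnW.
have chinj s t : site_potential s = site_potential t -> omega_at s =
  omega_at t /\ v_at s = v_at t.
  rewrite /site_potential /potential => /(mulIf (negbT (polyX_eq0 _))) /polyP e.
  have := e 0%N; have := e 1%N.
  by rewrite !coefD !coefC !coefZ !coefX /= !mulr0 !mulr1 !add0r !addr0.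
move=> wp wq; rewrite /center_potential.
have gp : all (@good_site R) (center_part a p) by case/andP:
  (weak_pair_filter (fun s => site s == a) wp).
have gq : all (@good_site R) (center_part a q) by case/andP:
  (weak_pair_filter (fun s => site s == a) wq).
move: wp wq gp gq => /andP[/(center_cases a)[->|[s -> sa]] _]
  /andP[/(center_cases a)[->|[t -> ta]] _] //=;
    rewrite ?big_seq1 ?big_nil ?andbT.
- by move=> _ gt e; have := ch0 _ gt; rewrite -e eqxx.
- by move=> gs _ e; have := ch0 _ gs; rewrite e eqxx.
- by move=> _ _ /chinj[ew ev]; congr [:: _]; apply: site_ext; rewrite ?sa ?ta.
Qed.

(** The Green function on the diagonal at [a] is [green_num] over [slope]. *)
Definition green_num a p := right_value a p * left_value a p.

(** The Wronskian without the site at [a]. *)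
Definition proper_part a p :=
  right_slope a p * left_value a p + right_value a p * left_slope a p
  - green_num a p.

Lemma slope_proper a p : weak_pair p ->
  slope p = proper_part a p - center_potential a p * green_num a p.
Proof.
by move=> /andP[/(slope_split a) -> _]; rewrite /proper_part /green_num; ring.
Qed.

(** The two ratios slope / value have limits 1 / tau with 0 < tau <= 1 at
    infinity, so the leading terms do not cancel. *)
Lemma size_proper a p : weak_pair p -> size (proper_part a p) =
  size (green_num a p).
Proof.
move=> wp; rewrite /proper_part /green_num.
have [szr [tr /andP[tr0 tr1] lr]] := halfline_lead (halfline_right a wp).
have [szl [tl /andP[tl0 tl1] ll]] := halfline_lead (halfline_left a wp).
rewrite -/(right_value a p) -/(left_value a p) -/(right_slope a p)
  -/(left_slope a p) in szr szl lr ll *.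
have ur0 : right_slope a p != 0 by rewrite horner0_neq0 ?slope0.
have ul0 : left_slope a p != 0 by rewrite horner0_neq0 ?slope0.
have vr0 : right_value a p != 0 by rewrite horner0_neq0 ?value0.
have vl0 : left_value a p != 0 by rewrite horner0_neq0 ?value0.
set P := right_slope a p * left_value a p.
set Q := right_value a p * left_slope a p.
set K := right_value a p * left_value a p.
have K0 : K != 0 by rewrite mulf_neq0.
have szP : size P = size K by rewrite !size_mul// szr.
have szQ : size Q = size K by rewrite !size_mul// szl.
have le : (size (P + Q - K)%R <= size K)%N.
  rewrite (leq_trans (size_polyD _ _))// size_polyN geq_max leqnn andbT.
  by rewrite (leq_trans (size_polyD _ _))// szP szQ maxnn.
apply/eqP; rewrite eqn_leq le leqNgt; apply/negP => lt.
have : (P + Q - K)`_(size K).-1 == 0.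
  by rewrite nth_default// -ltnS prednK// size_poly_gt0.
rewrite !coefD coefN -{1}szP -{1}szQ -!lead_coefE !lead_coefM lr ll.
set x := lead_coef _; set y := lead_coef _.
have -> : x * (tl * y) + tr * x * y - tr * x * (tl * y) =
  x * y * (tr + tl * (1 - tr)) by ring.
rewrite !mulf_eq0 !lead_coef_eq0 (negPf ur0) (negPf ul0)/= gt_eqF//.
by rewrite ltr_pwDl// mulr_ge0 ?subr_ge0// ltW.
Qed.

Lemma center_potential0 a p : (center_potential a p).[0] = 0.
Proof. by rewrite horner_sum big1// => s _; rewrite potential0. Qed.

Lemma green_num0 a p : (green_num a p).[0] = 1.
Proof. by rewrite hornerM !value0 mulr1. Qed.

Lemma size_green_num_le a p : weak_pair p ->
  (size (green_num a p) <= size (slope p) <= (size (green_num a p)).+2)%N.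
Proof.
move=> wp; rewrite (slope_proper a wp); set k := center_potential a p.
have szN := size_proper a wp; set N := proper_part a p in szN *.
have K0 : green_num a p != 0 by rewrite horner0_neq0// green_num0.
have [->|k0] := eqVneq k 0; first by rewrite mul0r subr0 szN leqnn/= leqW.
have k3 : (size k <= 3)%N.
  have [/(center_cases a) + _] := andP wp; rewrite /k /center_potential.
  case=> [->|[s -> _]]; rewrite ?big_nil ?size_poly0// big_seq1.
  have := size_affine (omega_at s) (v_at s);
    rewrite addrC /site_potential /potential => h.
  by rewrite (leq_trans (size_polyMleq _ _))// size_polyX addn2.
have k2 : (1 < size k)%N.
  rewrite ltnNge; apply/negP => /size1_polyC kE.
  have := center_potential0 a p; rewrite -/k kE hornerC => c0.
  by move: k0; rewrite kE c0 eqxx.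
have lt : (size N < size (k * green_num a p)%R)%N.
  by rewrite szN (size_mul k0 K0); case: (size k) k2 => [|[|n]] //= _;
    rewrite !addSn /= ltnS leq_addl.
rewrite addrC size_polyDl ?size_polyN// -szN ltnW//= (size_mul k0 K0).
by rewrite -szN -subn1 leq_subLR add1n -addn3 addnC leq_add2l.
Qed.

End Parts.

(** * Distributing the roots of the Green function *)

Section Polys.
Variable R : rcfType.
Implicit Types (f g h A B U V K : {poly R}) (ps xs : seq R).

Lemma simple_roots_eq A B ps qs : simple_roots A ps -> simple_roots B qs ->
  A.[0] = 1 -> B.[0] = 1 -> (forall x, root A x = root B x) -> A = B.
Proof.
move=> sA sB A0 B0 AB; have [_ ups eA] := sA; have [_ uqs eB] := sB.
have pq : perm_eq ps qs.
  by apply: uniq_perm => // x; rewrite -(simple_roots_root _ sA) AB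
    (simple_roots_root _ sB).
rewrite (perm_big _ pq) /= in eA; move: A0 B0; rewrite eA eB !hornerZ.
set P := \prod_(_ <- _) _ => lA lB; congr (_ *: _).
have P0 : P.[0] != 0.
  by apply: contra_eqN lA => /eqP ->; rewrite mulr0 eq_sym oner_eq0.
by apply: (mulIf P0); rewrite lA lB.
Qed.

Lemma simple_roots_divX A ps : A.[0] = 1 -> simple_roots ('X * A) ps ->
  simple_roots A (rem 0 ps).
Proof.
move=> A0 sA; have A0n := horner0_neq0 A0; have [_ ups e] := sA.
have ps0 : 0 \in ps by rewrite -(simple_roots_root _ sA) rootM rootX eqxx.
split=> //; first exact: rem_uniq.
have : ('X : {poly R}) != 0 by rewrite polyX_eq0.
move=> /mulfI; apply; rewrite e (big_rem 0)//= subr0 lead_coefM lead_coefX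
  mul1r.
by rewrite scalerAr.
Qed.

Lemma simple_roots_mulX A ps : A.[0] = 1 -> simple_roots A ps ->
  simple_roots ('X * A) (0 :: ps).
Proof.
move=> A0 sA; have [A0n ups e] := sA; split.
- by rewrite mulf_neq0 ?polyX_eq0.
- rewrite /= ups andbT -(simple_roots_root _ sA) rootE A0 oner_eq0//.
- by rewrite big_cons subr0 lead_coefM lead_coefX mul1r scalerAr -e.
Qed.

(** Newton's scheme: the nodes are added one at a time. *)
Lemma interpolation (v : R -> R) xs : uniq xs ->
  exists2 h : {poly R}, (size h <= size xs)%N & forall x, x \in xs -> h.[x] =
    v x.
Proof.
elim: xs => [|x xs IH] /=; first by exists 0; rewrite ?size_poly0.
move=> /andP[xxs /IH[h szh hv]].
pose g := \prod_(y <- xs) ('X - y%:P).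
have gx : g.[x] != 0 by rewrite -rootE root_prod_XsubC.
exists (h + ((v x - h.[x]) / g.[x]) *: g).
  rewrite (leq_trans (size_polyD _ _))// geq_max leqW//=.
  by rewrite (leq_trans (size_scale_leq _ _))// size_prod_XsubC.
move=> y; rewrite in_cons hornerD hornerZ => /orP[/eqP ->|yxs].
  by rewrite divfK// addrC subrK.
have /rootP -> : root g y by rewrite root_prod_XsubC.
by rewrite mulr0 addr0 hv.
Qed.

(** The polynomial U with U(0) = 1 and U B = V at the roots of A. The sign
    hypothesis is the positivity of the residues of - U / (z A). *)
Lemma string_pair_interpolation V A B ps : A.[0] = 1 -> simple_roots A ps ->
  (forall x, root A x -> B.[x] != 0 /\ 0 < V.[x] * (x * (A * B)^`().[x])) ->
  exists2 U, string_pair A U & forall x, root A x -> U.[x] * B.[x] = V.[x].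
Proof.
move=> A0 sA ABV; have sXA := simple_roots_mulX A0 sA; have [_ uXA _] := sXA.
have [U szU Uv] := interpolation (fun x => if x == 0 then 1 else V.[x] / B.[x])
  uXA.
have rA x : root A x -> x != 0 /\ x \in ps.
  move=> Ax; rewrite -(simple_roots_root _ sA); split=> //.
  by apply: contraTneq Ax => ->; rewrite rootE A0 oner_eq0.
have U0 : U.[0] = 1 by rewrite Uv ?mem_head ?eqxx.
have UB x : root A x -> U.[x] * B.[x] = V.[x].
  move=> Ax; have [x0 xps] := rA x Ax; have [Bx _] := ABV x Ax.
  by rewrite Uv ?in_cons ?xps ?orbT// (negPf x0) divfK.
have szU' : (size U <= size A)%N by rewrite (simple_roots_size sA).
exists U => //; split=> //; exists (0 :: ps) => //.
have An0 := horner0_neq0 A0; split.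
- move=> x; rewrite derivM derivX mul1r hornerD hornerM hornerX rootM rootX
  hornerN.
  move=> /orP[/eqP ->|Ax]; first by rewrite mul0r addr0 A0 U0 mulr1 ltrN10.
  have [x0 _] := rA x Ax; have [Bx] := ABV x Ax.
  rewrite derivM hornerD !hornerM (rootP Ax) mul0r addr0 add0r mulNr oppr_lt0
    -UB//.
  set u := U.[x]; set b := B.[x] in Bx *; set d := _.[x] => h.
  rewrite -(pmulr_lgt0 _ (_ : 0 < b ^+ 2)) ?exprn_even_gt0//.
  by have -> : u * (x * d) * b ^+ 2 = u * b * (x * (d * b)) by ring.
- by rewrite size_polyN size_mulXl// leqW// leqW.
- by rewrite nth_default ?mul0r// size_polyN size_mulXl// leqW.
Qed.

End Polys.

Section Unique.
Variable R : realType.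
Implicit Types (s : R * R * R) (p q l r c : pair_data R) (a x : R).

Definition disjoint_roots (K V : {poly R}) := forall x, root K x -> ~~ root V x.

Lemma slope_at_right_root a p x : weak_pair p -> root (right_value a p) x ->
  (slope p).[x] = (right_slope a p).[x] * (left_value a p).[x].
Proof.
move=> /andP[sp _] /rootP Ax; rewrite (slope_split a sp).
move: Ax; move: (right_value a p) (left_value a p) (right_slope a p)
  (left_slope a p).
move=> A B U L A0; rewrite !(hornerD, hornerN, hornerM) A0; ring.
Qed.

Lemma slope_at_left_root a p x : weak_pair p -> root (left_value a p) x ->
  (slope p).[x] = (left_slope a p).[x] * (right_value a p).[x].
Proof.
move=> /andP[sp _] /rootP Bx; rewrite (slope_split a sp).
move: Bx; move: (right_value a p) (left_value a p) (right_slope a p)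
  (left_slope a p).
move=> A B U L B0; rewrite !(hornerD, hornerN, hornerM) B0; ring.
Qed.

Lemma left_value_neq0 a p x : weak_pair p ->
  disjoint_roots (green_num a p) (slope p) ->
  root (right_value a p) x -> (left_value a p).[x] != 0.
Proof.
move=> wp dj Ax; apply: contraNneq (dj x _) => [Bx|]; last by rewrite rootM Ax.
by rewrite rootE (slope_at_right_root wp Ax) Bx mulr0.
Qed.

Lemma right_value_neq0 a p x : weak_pair p ->
  disjoint_roots (green_num a p) (slope p) ->
  root (left_value a p) x -> (right_value a p).[x] != 0.
Proof.
move=> wp dj Bx; apply: contraTneq Bx => Ax.
by rewrite rootE; apply: left_value_neq0 => //; apply/eqP.
Qed.

Lemma string_pair_right a p : weak_pair p ->
  string_pair (right_value a p) (right_slope a p).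
Proof. by move=> /(halfline_right a)/halfline_string_pair. Qed.

Lemma string_pair_left a p : weak_pair p ->
  string_pair (left_value a p) (left_slope a p).
Proof. by move=> /(halfline_left a)/halfline_string_pair. Qed.

Lemma string_pair_simple (A U : {poly R}) : string_pair A U ->
  exists ps, simple_roots A ps.
Proof.
by move=> [A0 _ _ [ps sA _]]; exists (rem 0 ps); apply: simple_roots_divX.
Qed.

Lemma string_pair_eq (A B U U' : {poly R}) : string_pair A U ->
  string_pair A U' ->
  (forall x, root A x -> B.[x] != 0 /\ U.[x] * B.[x] = U'.[x] * B.[x]) -> U =
    U'.
Proof.
move=> H H' e; have [ps sA] := string_pair_simple H.
have [A0 U0 szU _] := H; have [_ U'0 szU' _] := H'.
have [_ uXA _] := simple_roots_mulX A0 sA.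
apply/eqP; rewrite -subr_eq0; apply/eqP/(roots_geq_poly_eq0 (rs := 0 :: ps))
  => //.
  rewrite /= rootE hornerD hornerN U0 U'0 subrr eqxx; apply/allP => x xps.
  have Ax : root A x by rewrite (simple_roots_root _ sA).
  have [Bx] := e x Ax; move=> /(mulIf Bx) ex.
  by rewrite rootE hornerD hornerN ex subrr.
rewrite (leq_trans (size_polyD _ _))// size_polyN /= -(simple_roots_size sA).
by rewrite geq_max szU szU'.
Qed.

(** The roots of the right value determine both values, the slopes by
    interpolation at these roots and at 0, then the potential at [a], and so all
    the sites. *)
Lemma weak_pair_unique a p q : weak_pair p -> weak_pair q -> slope p =
  slope q ->
  green_num a p = green_num a q -> disjoint_roots (green_num a p) (slope p) ->
  (forall x, root (right_value a p) x = root (right_value a q) x) -> p = q.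
Proof.
move=> wp wq eV eK dj er; have djq := dj; rewrite eV eK in djq.
have [hrp hlp] := (string_pair_right a wp, string_pair_left a wp).
have [hrq hlq] := (string_pair_right a wq, string_pair_left a wq).
have [rp srp] := string_pair_simple hrp; have [rq srq] :=
  string_pair_simple hrq.
have eA : right_value a p = right_value a q.
  by apply: (simple_roots_eq srp srq); rewrite ?value0.
have eB : left_value a p = left_value a q.
  have An0 : right_value a q != 0 by rewrite horner0_neq0 ?value0.
  by apply: (mulfI An0); rewrite -{1}eA.
have eU : right_slope a p = right_slope a q.
  rewrite eA in hrp; apply: (string_pair_eq (B := left_value a q) hrp hrq) => x
    Ax.
  rewrite left_value_neq0//; split=> //; rewrite -slope_at_right_root//.
  by rewrite -eB -slope_at_right_root ?eV// eA.
have eL : left_slope a p = left_slope a q.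
  rewrite eB in hlp; apply: (string_pair_eq (B := right_value a q) hlp hlq) => x
    Bx.
  rewrite right_value_neq0//; split=> //; rewrite -slope_at_left_root//.
  by rewrite -eA -slope_at_left_root ?eV// eB.
have ec : center_potential a p = center_potential a q.
  have Kn0 : green_num a q != 0 by rewrite horner0_neq0 ?green_num0.
  apply: (mulIf Kn0); move: eV; rewrite (slope_proper a wp) (slope_proper a wq).
  by rewrite /proper_part eU eB eA eL eK => /addrI/oppr_inj.
rewrite (weak_pair_assemble a wp) (weak_pair_assemble a wq).
rewrite (center_potential_inj wp wq ec).
rewrite (halfline_inj (halfline_right a wp) (halfline_right a wq) eA eU).
by rewrite (halfline_inj (halfline_left a wp) (halfline_left a wq) eB eL).
Qed.

(** At a root x of A one has V = U B and K' = A' B, so the expression is B^2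
    times the positive quantity U(x) x A'(x); the same holds at the roots of B.
    *)
Lemma green_num_sign a p x : weak_pair p ->
  disjoint_roots (green_num a p) (slope p) ->
  root (green_num a p) x -> 0 < (slope p).[x] * (x * (green_num a p)^`().[x]).
Proof.
move=> wp dj.
have aux (A B U : {poly R}) : string_pair A U -> root A x -> B.[x] != 0 ->
    0 < U.[x] * B.[x] * (x * (A * B)^`().[x]).
  move=> [A0 _ _ [_ _ [sgn _ _]]] Ax Bx.
  have := sgn x; rewrite rootM Ax orbT derivM derivX mul1r hornerD hornerM
    hornerX.
  rewrite (rootP Ax) add0r hornerN mulNr oppr_lt0 => /(_ isT) pos.
  rewrite derivM hornerD !hornerM (rootP Ax) mul0r addr0.
  have -> : U.[x] * B.[x] * (x * (A^`().[x] * B.[x])) =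
    U.[x] * (x * A^`().[x]) * B.[x] ^+ 2 by ring.
  by rewrite mulr_gt0// exprn_even_gt0.
rewrite rootM => /orP[Ax|Bx].
  rewrite (slope_at_right_root wp Ax); apply: aux => //;
    first exact: string_pair_right.
  exact: left_value_neq0.
rewrite (slope_at_left_root wp Bx) /green_num [right_value a p * _]mulrC;
  apply: aux => //.
  exact: string_pair_left.
exact: right_value_neq0.
Qed.

Lemma green_num_simple a p : weak_pair p ->
  disjoint_roots (green_num a p) (slope p) ->
  exists ks, simple_roots (green_num a p) ks.
Proof.
move=> wp dj.
have [ps sp] := string_pair_simple (string_pair_right a wp).
have [qs sq] := string_pair_simple (string_pair_left a wp).
exists (ps ++ qs); have [pn0 up ep] := sp; have [qn0 uq eq] := sq; split.
- by rewrite mulf_neq0.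
- rewrite cat_uniq up uq andbT/=; apply/hasPn => x /=.
  rewrite -(simple_roots_root _ sp) -(simple_roots_root _ sq) => Bx.
  by rewrite rootE right_value_neq0.
- rewrite big_cat /= lead_coefM {1}/green_num {1}ep {1}eq.
  by rewrite -scalerAl -scalerAr scalerA.
Qed.

(** [P] tells which roots of K are given to the right half-line. Since the signs
    in [green_num_sign] involve V and K only, both halves can be built by
    interpolation; the site at [a] is kept. *)
Lemma weak_pair_exists a p (P : pred R) : weak_pair p ->
  disjoint_roots (green_num a p) (slope p) ->
  exists q, [/\ weak_pair q, slope q = slope p, green_num a q = green_num a p &
    forall x, root (right_value a q) x = root (green_num a p) x && P x].
Proof.
move=> wp dj; have [ks sK] := green_num_simple wp dj; have [Kn0 uks eK] := sK.
set K := green_num a p in sK Kn0 eK *; set V := slope p in dj *.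
have K0 : K.[0] = 1 by rewrite green_num0.
pose part (S : seq R) : {poly R} :=
  (\prod_(x <- S) - x)^-1 *: \prod_(x <- S) ('X - x%:P).
have ksn0 x : x \in ks -> x != 0.
  rewrite -(simple_roots_root _ sK); apply: contraTneq => ->.
  by rewrite rootE K0 oner_eq0.
have part_spec (S : seq R) : uniq S -> {subset S <= ks} ->
    (part S).[0] = 1 /\ simple_roots (part S) S.
  move=> uS Sks; have n0 : \prod_(x <- S) - x != 0.
    by rewrite prodf_seq_neq0; apply/allP => x /Sks/ksn0; rewrite oppr_eq0.
  split.
    rewrite hornerZ horner_prod; set P0 := (X in _ * X).
    have -> : P0 = \prod_(x <- S) - x.
      by apply: eq_bigr => x _; rewrite hornerXsubC sub0r.
    by rewrite mulVf.
  have mn : \prod_(x <- S) ('X - x%:P) \is monic by apply: monic_prod_XsubC.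
  split=> //.
    by rewrite scaler_eq0 invr_eq0 (negPf n0) monic_neq0.
  by rewrite lead_coefZ (monicP mn) mulr1.
pose S := [seq x <- ks | P x]; pose T := [seq x <- ks | ~~ P x].
have subS : {subset S <= ks} by move=> x; rewrite mem_filter => /andP[].
have subT : {subset T <= ks} by move=> x; rewrite mem_filter => /andP[].
have [A0 sA] := part_spec S (filter_uniq _ uks) subS.
have [B0 sB] := part_spec T (filter_uniq _ uks) subT.
set A := part S in A0 sA; set B := part T in B0 sB.
have rA x : root A x = root K x && P x.
  by rewrite (simple_roots_root _ sA) mem_filter andbC (simple_roots_root _ sK).
have rB x : root B x = root K x && ~~ P x.
  by rewrite (simple_roots_root _ sB) mem_filter andbC (simple_roots_root _ sK).
have AB : A * B = K.
  have [An0 uA eA] := sA; have [Bn0 uB eB] := sB.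
  have sAB : simple_roots (A * B) (S ++ T).
    split; first by rewrite mulf_neq0.
      rewrite cat_uniq uA uB andbT/=; apply/hasPn => x /=.
      by rewrite !mem_filter => /andP[/negPf ->].
    by rewrite big_cat /= lead_coefM {1}eA {1}eB -scalerAl -scalerAr scalerA.
  apply: (simple_roots_eq sAB sK) => // [|x]; first by rewrite hornerM A0 B0
    mulr1.
  by rewrite rootM rA rB -andb_orr orbN andbT.
have [U hU UB] : exists2 U, string_pair A U & forall x, root A x ->
  U.[x] * B.[x] = V.[x].
  apply: (string_pair_interpolation A0 sA) => x; rewrite rA => /andP[Kx Px].
  by rewrite -rootE rB Px andbF AB green_num_sign.
have [L hL LA] : exists2 L, string_pair B L & forall x, root B x ->
  L.[x] * A.[x] = V.[x].
  apply: (string_pair_interpolation B0 sB) => x; rewrite rB => /andP[Kx Px].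
  by rewrite -rootE rA (negPf Px) andbF [B * A]mulrC AB green_num_sign.
have [r hr [rvA rsU]] := halfline_surj a hU.
have [l hl [lvB lsL]] := halfline_surj (- a) hL.
have cw : weak_pair (center_part a p) by apply: weak_pair_filter.
have ca : all (fun s => site s == a) (center_part a p) by apply: filter_all.
have [wq ql qc qr] := assembleP hl hr cw ca.
set q := assemble l _ r in wq ql qc qr.
have Kq : green_num a q = K.
  by rewrite /green_num /right_value /left_value ql qr rvA lvB.
exists q; split=> //; last by move=> x; rewrite /right_value qr rvA rA.
rewrite (slope_proper a wq) Kq /V (slope_proper a wp) -/K; congr (_ - _);
  last by rewrite /center_potential qc.
(* both proper parts have degree at most deg K and the same values at 0 and at
   the roots of K *)
have pq : proper_part a q = U * B + A * L - K.
  rewrite /proper_part /green_num /right_value /left_value /right_slope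
    /left_slope.
  by rewrite ql qr rvA lvB rsU lsL AB.
have szq := size_proper a wq; have szp := size_proper a wp.
rewrite Kq in szq.
apply/eqP; rewrite -subr_eq0; apply/eqP/(roots_geq_poly_eq0 (rs := 0 :: ks)).
- have proper0 t : weak_pair t -> (proper_part a t).[0] = 1.
    move=> wt; have := slope0 t; rewrite (slope_proper a wt) hornerD hornerN
      hornerM.
    by rewrite center_potential0 mul0r subr0.
  rewrite /= rootE hornerD hornerN !proper0// subrr eqxx; apply/allP => x.
  rewrite -(simple_roots_root _ sK) => Kx; rewrite rootE hornerD hornerN.
  have -> : (proper_part a p).[x] = V.[x].
    rewrite /V (slope_proper a wp) -/K; move: (proper_part a p) => N.
    by rewrite hornerD hornerN hornerM (rootP Kx) mulr0 subr0.
  rewrite pq hornerD hornerN (rootP Kx) subr0 hornerD !hornerM.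
  case: (boolP (P x)) => Px.
    have Ax : root A x by rewrite rA Kx.
    by rewrite UB// (rootP Ax) mul0r addr0 subrr.
  have Bx : root B x by rewrite rB Kx.
  by rewrite (rootP Bx) mulr0 add0r mulrC LA// subrr.
- by rewrite /= uks -(simple_roots_root _ sK) rootE K0 oner_eq0.
- rewrite (leq_trans (size_polyD _ _))// size_polyN szp -/K szq maxnn.
  by rewrite (simple_roots_size sK).
Qed.

End Unique.

(** * Counting *)

Section Count.
Variable R : realType.
Implicit Types (p q : pair_data R) (a x : R).

Lemma card_eq_set_bij (T : Type) (A : set T) (n : nat) (f : T -> nat) :
  (forall y, A y -> f y < n)%N ->
  (forall y z, A y -> A z -> f y = f z -> y = z) ->
  (forall m, (m < n)%N -> exists2 y, A y & f y = m) -> (A #= `I_n)%card.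
Proof.
move=> fn finj fsurj; apply/card_set_bijP; exists f; split.
- by move=> y Ay; exact: fn.
- by move=> y z /set_mem Ay /set_mem Az; exact: finj.
- by move=> m /= /fsurj[y Ay <-]; exists y.
Qed.

(** The set of the roots of K that belong to the right value is an arbitrary
    subset of the roots of K and characterizes the pair. *)
Lemma card_isospectral a p : weak_pair p ->
  disjoint_roots (green_num a p) (slope p) ->
  ([set q | [/\ weak_pair q, slope q = slope p & green_num a q = green_num a p]]
     #= `I_(2 ^ (size (green_num a p)).-1))%card.
Proof.
move=> wp dj; have [ks sK] := green_num_simple wp dj.
have -> : (size (green_num a p)).-1 = size ks by rewrite (simple_roots_size sK).
set d := size ks; have [_ uks _] := sK.
pose F q : {set 'I_d} := [set i : 'I_d | root (right_value a q) ks`_i]%SET.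
have -> : (2 ^ d = #|{set 'I_d}|)%N.
   by rewrite -cardsT -powersetT card_powerset cardsT card_ord.
apply: (card_eq_set_bij (f := fun q => enum_rank (F q))).
- by move=> q _; apply: ltn_ord.
- move=> q r [wq eV eK] [wr eV' eK'] /val_inj/enum_rank_inj/setP eF.
  apply: (weak_pair_unique (a := a)) => //; rewrite ?eV ?eK// => x.
  have [xks|xks] := boolP (x \in ks).
    have xd : (index x ks < d)%N by rewrite index_mem.
    by have := eF (Ordinal xd); rewrite !inE /= nth_index.
  have out t : green_num a t = green_num a p -> root (right_value a t) x =
    false.
    move=> et; apply: contraNF xks => tx.
    by rewrite -(simple_roots_root _ sK) -et rootM tx.
  by rewrite !out.
- move=> m mlt; pose S : {set 'I_d} := enum_val (Ordinal mlt).
  have [q [wq eV eK rq]] :=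
    weak_pair_exists (fun x => [exists i in S, x == ks`_(nat_of_ord i)]) wp dj.
  exists q => //; have -> : F q = S; last by rewrite enum_valK.
  apply/setP => i; rewrite inE rq (simple_roots_root _ sK) mem_nth//=.
  apply/existsP/idP => [[j /andP[jS /eqP e]]|iS]; last by exists i;
    rewrite iS eqxx.
  suff -> : i = j by [].
  by apply/val_inj/eqP; rewrite -(nth_uniq 0 _ _ uks) ?ltn_ord// e.
Qed.

End Count.

(** * The equation between two sites *)

Section Waves.
Variable R : realType.
Implicit Types (s : R * R * R) (p q : pair_data R) (a b x y t : R)
  (c : R[i] * R[i]).
Implicit Types (z : R[i]) (f g : R -> R[i]).

Definition rwave a b x : R := a * expR (- x / 2) + b * expR (x / 2).

Lemma is_derive_expR_scale k x :
  is_derive x 1 (fun y : R => expR (k * y)) (k * expR (k * x)).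
Proof.
have h : is_derive x 1 (fun y : R => k * y) k.
  by have := is_deriveZ k (is_derive_id x (1 : R));
    rewrite /GRing.scale /= mulr1.
by have := is_derive1_comp (is_derive_expR (k * x)) h; rewrite mulrC.
Qed.

Lemma rwaveE a b : rwave a b = fun x => a * expR (- 2^-1 * x) +
  b * expR (2^-1 * x).
Proof.
by apply/funext => x; rewrite /rwave; congr (_ * expR _ + _ * expR _); ring.
Qed.

Lemma is_derive_rwave a b x :
  is_derive x 1 (rwave a b) (rwave (- a / 2) (b / 2) x).
Proof.
rewrite !rwaveE.
have := is_deriveD (is_deriveZ a (is_derive_expR_scale (- 2^-1) x))
                   (is_deriveZ b (is_derive_expR_scale (2^-1) x)).
move/is_derive_eq; apply; rewrite /GRing.scale /=; ring.
Qed.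

(** Both quantities are (k h - h') e^{k x} with k = 1/2 and, up to sign, k = -
    1/2, and have derivative (k^2 - 1/4) h e^{k x} = 0. *)
Lemma ode_coords_const (h : R -> R) x y : x <= y ->
  (forall t, x <= t <= y -> [/\ derivable h t 1, derivable (derive1 h) t 1 &
     derive1 (derive1 h) t = h t / 4]) ->
  (h x / 2 - derive1 h x) * expR (x / 2) =
    (h y / 2 - derive1 h y) * expR (y / 2) /\
  (h x / 2 + derive1 h x) * expR (- x / 2) =
    (h y / 2 + derive1 h y) * expR (- y / 2).
Proof.
move=> xy ode.
have const (k : R) : k ^+ 2 = 1 / 4 ->
    (h x * k - derive1 h x) * expR (k * x) =
      (h y * k - derive1 h y) * expR (k * y).
  move=> k2; pose g t := (h t * k - derive1 h t) * expR (k * t).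
  have dg t : x <= t <= y -> is_derive t 1 g 0.
    move=> /ode[dh dh' hh].
    have i1 : is_derive t 1 h (derive1 h t) by rewrite derive1E;
      apply: derivableP.
    have i2 : is_derive t 1 (derive1 h) (h t / 4) by rewrite -hh derive1E;
      apply: derivableP.
    have := is_deriveM (is_deriveB (is_deriveZ k i1) i2)
      (is_derive_expR_scale k t).
    have -> : (k \*: h - derive1 h) * (fun y => expR (k * y)) = g.
      by apply/funext => u; rewrite /g [h u * k]mulrC.
    move/is_derive_eq; apply; rewrite /GRing.scale /=.
    transitivity ((k ^+ 2 - 1 / 4) * (h t * expR (k * t)));
      last by rewrite k2 subrr mul0r.
    by rewrite !fctE /= /GRing.scale /=; field.
  have cg : {within `[x, y], continuous g}.
    apply: derivable_within_continuous => t; rewrite in_itv /= => /dg[]//.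
  have [t _] := MVT_segment xy (fun t tin => dg t (subset_itv_oo_cc tin)) cg.
  by rewrite mul0r => /eqP; rewrite subr_eq0 => /eqP.
have e : (2^-1 : R) ^+ 2 = 1 / 4 by field.
have e' : (- 2^-1 : R) ^+ 2 = 1 / 4 by field.
split; first by have := const _ e; rewrite ![2^-1 * _]mulrC.
have := const _ e'; rewrite !mulrN -!opprD !mulNr => /oppr_inj.
by rewrite !(mulrC 2^-1).
Qed.

Definition wave c x : R[i] :=
  c.1 * (expR (- x / 2))%:C + c.2 * (expR (x / 2))%:C.
(** The coefficients of the derivative of [wave c]. *)
Definition dwave c : R[i] * R[i] := (- c.1 / 2, c.2 / 2).

Lemma half_Re (w : R[i]) : complex.Re (w / 2) = complex.Re w / 2.
Proof.
have -> : (2^-1 : R[i]) = (2^-1 : R)%:C by rewrite fmorphV rmorph_nat.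
by case: w => u v /=; rewrite mulr0 subr0.
Qed.

Lemma half_Im (w : R[i]) : complex.Im (w / 2) = complex.Im w / 2.
Proof.
have -> : (2^-1 : R[i]) = (2^-1 : R)%:C by rewrite fmorphV rmorph_nat.
by case: w => u v /=; rewrite mulr0 add0r.
Qed.

Lemma Re_wave c x :
  complex.Re (wave c x) = rwave (complex.Re c.1) (complex.Re c.2) x.
Proof. by case: c => [[a b] [a' b']]; rewrite /wave /rwave /= !mulr0 !subr0.
Qed.

Lemma Im_wave c x :
  complex.Im (wave c x) = rwave (complex.Im c.1) (complex.Im c.2) x.
Proof. by case: c => [[a b] [a' b']]; rewrite /wave /rwave /= !mulr0 !add0r.
Qed.

Lemma complexP (u v : R[i]) : complex.Re u = complex.Re v ->
  complex.Im u = complex.Im v -> u = v.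
Proof. by case: u v => a b [a' b'] /= -> ->. Qed.

Lemma near_wave f c x : (\forall t \near x, f t = wave c t) ->
  derivableC f x /\ deriveC f x = wave (dwave c) x.
Proof.
move=> fc; have [i1 i2] := (is_derive_rwave (complex.Re c.1) (complex.Re c.2) x,
                            is_derive_rwave (complex.Im c.1) (complex.Im c.2)
                              x).
have e1 : \forall t \near x, rwave (complex.Re c.1) (complex.Re c.2) t =
  complex.Re (f t).
  by apply: filterS fc => t ->; rewrite Re_wave.
have e2 : \forall t \near x, rwave (complex.Im c.1) (complex.Im c.2) t =
  complex.Im (f t).
  by apply: filterS fc => t ->; rewrite Im_wave.
have j1 := near_eq_is_derive e1 i1; have j2 := near_eq_is_derive e2 i2.
split; first by split; [case: j1 | case: j2].
apply: complexP; rewrite ?Re_wave ?Im_wave /= !(half_Re, half_Im) !raddfN /=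
  derive1E.
  exact: (@derive_val _ _ _ _ _ _ _ j1).
exact: (@derive_val _ _ _ _ _ _ _ j2).
Qed.

(** The coefficients of the solution that agrees with f to the first order at x.
    *)
Definition coords f x : R[i] * R[i] :=
  ((f x / 2 - deriveC f x) * (expR (x / 2))%:C,
   (f x / 2 + deriveC f x) * (expR (- x / 2))%:C).

Lemma expR_halfN x : (expR (x / 2))%:C * (expR (- x / 2))%:C = 1 :> R[i].
Proof. by rewrite -rmorphM -expRD mulNr subrr expR0. Qed.

Lemma two_neq0 : (2 : R[i]) != 0.
Proof. by rewrite pnatr_eq0. Qed.

Lemma wave_coords f x : f x = wave (coords f x) x /\
  deriveC f x = wave (dwave (coords f x)) x.
Proof.
have e1 := expR_halfN x; have two0 := two_neq0.
rewrite /wave /dwave /coords /=; move: (f x) (deriveC f x) => u d.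
set e := (expR _)%:C in e1 *; set e' := (expR _)%:C in e1 *.
split.
  have -> : (u / 2 - d) * e * e' + (u / 2 + d) * e' * e = u * (e * e') by field.
  by rewrite e1 mulr1.
have -> : - ((u / 2 - d) * e) / 2 * e' + (u / 2 + d) * e' / 2 * e =
  d * (e * e') by field.
by rewrite e1 mulr1.
Qed.

Lemma wave_inj c c' x : wave c x = wave c' x ->
  wave (dwave c) x = wave (dwave c') x -> c = c'.
Proof.
have e1 := expR_halfN x; have two0 := two_neq0; move: c c' => [a b] [a' b'].
rewrite /wave /dwave /=.
set e := (expR (x / 2))%:C in e1 *; set e' := (expR (- x / 2))%:C in e1 *.
have e0 : e != 0 by apply: contra_eq_neq e1 => ->;
  rewrite mul0r eq_sym oner_eq0.
have e'0 : e' != 0 by apply: contra_eq_neq e1 => ->;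
  rewrite mulr0 eq_sym oner_eq0.
move=> h1 h2.
have A : a * e' = a' * e'.
  have -> : a * e' = (a * e' + b * e) / 2 - (- a / 2 * e' + b / 2 * e) by field.
  by rewrite h1 h2; field.
move: h1; rewrite A => /addrI/(mulIf e0) ->.
by move/(mulIf e'0): A => ->.
Qed.

Definition sites p : seq R := [seq site s | s <- p].

Lemma coords_const p z f x y : is_solution p z f -> x <= y ->
  (forall t, x <= t <= y -> t \notin sites p) -> coords f x = coords f y.
Proof.
move=> [_ ode _] xy nos.
have half4 (w : R[i]) : complex.Re (4^-1 * w) = complex.Re w / 4 /\
    complex.Im (4^-1 * w) = complex.Im w / 4.
  have -> : (4^-1 : R[i]) = (4^-1 : R)%:C by rewrite fmorphV rmorph_nat.
  by case: w => u v /=; rewrite !mul0r subr0 addr0 ![_ / 4]mulrC.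
have Re_ode t : x <= t <= y -> [/\ derivable (fun t => complex.Re (f t)) t 1,
    derivable (derive1 (fun t => complex.Re (f t))) t 1 &
    derive1 (derive1 (fun t => complex.Re (f t))) t = complex.Re (f t) / 4].
  move=> /nos/ode[[d1 _] [d2 _] e]; split=> //.
  have := congr1 (@complex.Re R) e; rewrite raddfD raddfN /= (half4 _).1.
  by move=> /eqP; rewrite addrC subr_eq0 => /eqP ->.
have Im_ode t : x <= t <= y -> [/\ derivable (fun t => complex.Im (f t)) t 1,
    derivable (derive1 (fun t => complex.Im (f t))) t 1 &
    derive1 (derive1 (fun t => complex.Im (f t))) t = complex.Im (f t) / 4].
  move=> /nos/ode[[_ d1] [_ d2] e]; split=> //.
  have := congr1 (@complex.Im R) e; rewrite raddfD raddfN /= (half4 _).2.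
  by move=> /eqP; rewrite addrC subr_eq0 => /eqP ->.
have [r1 r2] := ode_coords_const xy Re_ode.
have [i1 i2] := ode_coords_const xy Im_ode.
have ReM (w : R[i]) (e : R) : complex.Re (w * e%:C) = complex.Re w * e.
  by case: w => ? ? /=; rewrite mulr0 subr0.
have ImM (w : R[i]) (e : R) : complex.Im (w * e%:C) = complex.Im w * e.
  by case: w => ? ? /=; rewrite mulr0 add0r.
rewrite /coords; congr (_, _); apply: complexP;
  rewrite ?ReM ?ImM !raddfD ?raddfN /=;
  by rewrite !(half_Re, half_Im).
Qed.

End Waves.

(** * Crossing a site *)

Section Crossing.
Variable R : realType.
Implicit Types (s : R * R * R) (p : pair_data R) (a b x t : R).
Implicit Types (c : R[i] * R[i]) (z : R[i]) (f g : R -> R[i]).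

Definition ccross z s c := cross (fun x : R => x%:C) z s c.
Definition ctransfer z p c := foldr (ccross z) c p.

(** The sites to the right of t, and with them the coefficients of a solution,
    do not depend on t near a point, on each side of it. *)
Lemma near_right_part p x : \forall t \near x^'+, right_part t p =
  right_part x p.
Proof.
elim: p => [|s p IH]; first exact: nearW.
have [sx|xs] := leP (site s) x.
  near=> t; have st : site s < t.
    by rewrite (le_lt_trans sx)//; near: t; exact: nbhs_right_gt.
  by rewrite /right_part /= (lt_gtF st) ltNge sx /=; near: t.
near=> t; rewrite /right_part /= xs; have -> : t < site s.
  by near: t; exact: nbhs_right_lt.
by congr (_ :: _); near: t.
Unshelve. all: by end_near. Qed.

Lemma near_left_part p x :
  \forall t \near x^'-, right_part t p = [seq s <- p | x <= site s].
Proof.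
elim: p => [|s p IH]; first exact: nearW.
have [xs|sx] := leP x (site s).
  near=> t; rewrite /right_part /= xs; have -> : t < site s.
    by rewrite (lt_le_trans _ xs)//; near: t; exact: nbhs_left_lt.
  by congr (_ :: _); near: t.
near=> t; have st : site s < t by near: t; exact: nbhs_left_gt.
by rewrite /right_part /= [x <= _]leNgt sx (lt_gtF st) /=; near: t.
Unshelve. all: by end_near. Qed.

Lemma right_part_nosite p x : x \notin sites p ->
  [seq s <- p | x <= site s] = right_part x p.
Proof.
move=> xp; apply: eq_in_filter => s sp; rewrite le_eqVlt.
case: eqP => // xs; case/negP: xp; rewrite xs; exact: map_f.
Qed.

Lemma near_part_nosite p x : x \notin sites p ->
  \forall t \near x, right_part t p = right_part x p.
Proof.
elim: p => [|s p IH]; first by move=> _; near=> t.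
rewrite /sites /= in_cons negb_or => /andP[xs /IH{}IH].
case: (ltgtP x (site s)) xs => // [xs|sx] _; near=> t.
  have st : t < site s by near: t; exact: lt_nbhsl.
  by rewrite /right_part /= st; congr (_ :: _); near: t.
have st : site s < t by near: t; exact: lt_nbhsr.
by rewrite (lt_gtF st); near: t.
Unshelve. all: by end_near. Qed.

Lemma near_right_nosite p x : \forall t \near x^'+, t \notin sites p.
Proof.
elim: p => [|s p IH]; first exact: nearW.
have [sx|xs] := leP (site s) x; near=> t.
  have st : site s < t.
    by rewrite (le_lt_trans sx)//; near: t; exact: nbhs_right_gt.
  by rewrite /sites /= in_cons gt_eqF//=; near: t.
have st : t < site s by near: t; exact: nbhs_right_lt.
by rewrite /sites /= in_cons lt_eqF//=; near: t.
Unshelve. all: by end_near. Qed.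

Lemma near_left_nosite p x : \forall t \near x^'-, t \notin sites p.
Proof.
elim: p => [|s p IH]; first exact: nearW.
have [xs|sx] := leP x (site s); near=> t.
  have st : t < site s.
    by rewrite (lt_le_trans _ xs)//; near: t; exact: nbhs_left_lt.
  by rewrite /sites /= in_cons lt_eqF//=; near: t.
have st : site s < t by near: t; exact: nbhs_left_gt.
by rewrite /sites /= in_cons gt_eqF//=; near: t.
Unshelve. all: by end_near. Qed.

Lemma near_pinfty_part p : \forall t \near +oo, right_part t p = [::].
Proof.
elim: p => [|s p IH]; first exact: nearW.
near=> t; have st : site s < t by near: t; apply: nbhs_pinfty_gt;
  rewrite num_real.
by rewrite /right_part /= (lt_gtF st); near: t.
Unshelve. all: by end_near. Qed.

Lemma near_pinfty_nosite p : \forall t \near +oo, forall u, t <= u ->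
  u \notin sites p.
Proof.
elim: p => [|s p IH]; first exact: nearW.
near=> t; move=> u tu; rewrite /sites /= in_cons negb_or; apply/andP; split.
  have st : site s < t by near: t; apply: nbhs_pinfty_gt; rewrite num_real.
  by rewrite gt_eqF// (lt_le_trans st).
by move: u tu; near: t.
Unshelve. all: by end_near. Qed.

(** The matrix of [cross] realizes the jump condition of the equation. *)
Lemma cross_wave z s c :
  wave (ccross z s c) (site s) = wave c (site s) /\
  wave (dwave (ccross z s c)) (site s) = wave (dwave c) (site s)
    + z * (omega_at s)%:C * wave c (site s) + z ^+ 2 * (v_at s)%:C * wave c
      (site s).
Proof.
case: c => u w; rewrite /ccross /cross /wave /dwave /=; set x := site s.
have e1 := expR_halfN x; have two0 := two_neq0 R.
have -> : expR x = expR (x / 2) * expR (x / 2) by rewrite -expRD -splitr.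
have -> : expR (- x) =
  expR (- x / 2) * expR (- x / 2) by rewrite -expRD -splitr.
rewrite !(rmorphM (real_complex R)) /=.
set e := (expR (x / 2))%:C in e1 *; set e' := (expR (- x / 2))%:C in e1 *.
set k := (_ + _ * z) * z; split.
  have -> : (u - k * (u + e * e * w)) * e' +
    (w + k * (e' * e') * (u + e * e * w)) * e
    = u * e' + w * e + (e * e' - 1) * (k * e' * (u + e * e * w)) by ring.
  by rewrite e1 subrr mul0r addr0.
have -> : - (u - k * (u + e * e * w)) / 2 * e' +
  (w + k * (e' * e') * (u + e * e * w)) / 2 * e
  = - u / 2 * e' + w / 2 * e + k * (u * e' + w * e)
    + (e * e' - 1) * (k * (u * e' / 2 + e * w * (1 + e * e') / 2 + e * w / 2))
      by field.
rewrite e1 subrr mul0r addr0 /k; ring.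
Qed.

Lemma continuous_rwave a b : continuous (rwave a b).
Proof.
move=> x; apply: differentiable_continuous; apply/derivable1_diffP.
by case: (is_derive_rwave a b x).
Qed.

Lemma cvgC_wave c x : cvgC (wave c) (nbhs x) (wave c x).
Proof.
split; rewrite ?Re_wave ?Im_wave.
  by rewrite (funext (Re_wave c)); exact: continuous_rwave.
by rewrite (funext (Im_wave c)); exact: continuous_rwave.
Qed.

Lemma cvgC_wave_left c x : cvgC (wave c) x^'- (wave c x).
Proof. by have [h1 h2] := cvgC_wave c x; split; apply: cvg_at_left_filter. Qed.

Lemma cvgC_wave_right c x : cvgC (wave c) x^'+ (wave c x).
Proof. by have [h1 h2] := cvgC_wave c x; split; apply: cvg_at_right_filter. Qed.

Lemma cvgC_near (F : set_system R) (FF : Filter F) f g l :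
  (\forall t \near F, f t = g t) -> cvgC g F l -> cvgC f F l.
Proof.
move=> fg [h1 h2]; split.
  by apply: cvg_trans h1; apply: near_eq_cvg; apply: filterS fg => t ->.
by apply: cvg_trans h2; apply: near_eq_cvg; apply: filterS fg => t ->.
Qed.

Lemma cvgC_unique (F : set_system R) (FF : ProperFilter F) f l l' :
  cvgC f F l -> cvgC f F l' -> l = l'.
Proof.
move=> [h1 h2] [k1 k2]; apply: complexP.
  exact: (cvg_unique _ h1 k1).
exact: (cvg_unique _ h2 k2).
Qed.

Lemma continuousC_left f x : continuousC f -> cvgC f x^'- (f x).
Proof. by move=> [h1 h2]; split; apply: cvg_at_left_filter;
  [exact: h1|exact: h2]. Qed.

Lemma continuousC_right f x : continuousC f -> cvgC f x^'+ (f x).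
Proof. by move=> [h1 h2]; split; apply: cvg_at_right_filter;
  [exact: h1|exact: h2]. Qed.

Lemma solution_right_value p z f x c : is_solution p z f ->
  (\forall t \near x^'+, coords f t = c) -> f x = wave c x.
Proof.
move=> [cf _ _] fc; apply: cvgC_unique (continuousC_right x cf) _.
apply: cvgC_near (cvgC_wave_right c x).
by apply: filterS fc => t <-; have [] := wave_coords f t.
Qed.

Lemma solution_jump p z f s cl cr : is_solution p z f -> s \in p ->
  (\forall t \near (site s)^'-, coords f t = cl) ->
  (\forall t \near (site s)^'+, coords f t = cr) -> cl = ccross z s cr.
Proof.
move=> sf sp hl hr; have fr := solution_right_value sf hr.
have [cf _ /(_ s sp)[l [r [cl' cr' jump]]]] := sf.
have fl : f (site s) = wave cl (site s).
  apply: cvgC_unique (continuousC_left _ cf) _.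
  apply: cvgC_near (cvgC_wave_left cl _).
  by apply: filterS hl => t <-; have [] := wave_coords f t.
have le : l = wave (dwave cl) (site s).
  apply: cvgC_unique cl' _; apply: cvgC_near (cvgC_wave_left _ _).
  by apply: filterS hl => t <-; have [] := wave_coords f t.
have re : r = wave (dwave cr) (site s).
  apply: cvgC_unique cr' _; apply: cvgC_near (cvgC_wave_right _ _).
  by apply: filterS hr => t <-; have [] := wave_coords f t.
have [x1 x2] := cross_wave z s cr.
apply: (wave_inj (x := site s)); first by rewrite -fl fr x1.
by rewrite -le jump re x2 fr.
Qed.

End Crossing.

(** * Global solutions *)

Section Solutions.
Variable R : realType.
Implicit Types (s : R * R * R) (p q : pair_data R) (a b x y t : R)
  (c : R[i] * R[i]).
Implicit Types (z : R[i]) (f g : R -> R[i]).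

Lemma right_part_next p x s r : sites_sorted p -> right_part x p = s :: r ->
  [/\ s \in p, x < site s, right_part (site s) p = r &
     forall t, x < t -> t < site s -> t \notin sites p].
Proof.
move=> sp e; have sr := sorted_filter_map (fun s => x < site s) sp.
have : s \in right_part x p by rewrite e mem_head.
rewrite mem_filter => /andP[xs sinp]; split=> //.
  rewrite -/(right_part x p) e in sr.
  rewrite -(right_part_head sr) -e /right_part -filter_predI;
    apply: eq_filter => u /=.
  by case: ltP => //= su; rewrite (lt_trans xs su).
move=> t xt ts; apply/negP => /mapP[u up tu].
have : u \in right_part x p by rewrite mem_filter up -tu xt.
rewrite e in_cons => /orP[/eqP us|ur]; first by move: ts; rewrite tu us ltxx.
rewrite -/(right_part x p) e in sr; have := order_path_min lt_trans sr.
by rewrite all_map => /allP /(_ _ ur) /=; rewrite -tu ltNge (ltW ts).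
Qed.

Lemma right_part_nil p x : right_part x p = [::] ->
  forall t, x < t -> t \notin sites p.
Proof.
move=> e t xt; apply/negP => /mapP[u up tu].
have : u \in right_part x p by rewrite mem_filter up -tu xt.
by rewrite e.
Qed.

Lemma right_part_eq p x y : x <= y ->
  (forall t, x < t -> t <= y -> t \notin sites p) -> right_part y p =
    right_part x p.
Proof.
move=> xy no; apply: eq_in_filter => s sp.
case: (ltP x (site s)) => [xs|sx]; last by apply/negbTE;
  rewrite -leNgt (le_trans sx).
by rewrite ltNge; apply/negP => sy; have /negP[] := no _ xs sy; apply: map_f.
Qed.

Lemma right_gap p s r : sites_sorted p -> right_part (site s) p = r ->
  exists2 y, site s < y & forall t, site s < t -> t <= y -> t \notin sites p.
Proof.
move=> sp; case: r => [|s2 r] e.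
  exists (site s + 1); first by rewrite ltrDl.
  by move=> t st _; apply: right_part_nil e _ st.
have [_ ss2 _ no] := right_part_next sp e.
exists ((site s + site s2) / 2); first by rewrite midf_lt.
by move=> t st ty; apply: no => //; rewrite (le_lt_trans ty)// midf_lt.
Qed.

(** The coefficients of a solution are constant between consecutive sites and
    change by [ccross] at a site: induction on the number of sites to the right
    of the point, starting from +oo. *)
Lemma solution_structure p z f : sites_sorted p -> is_solution p z f ->
  exists c, (\forall t \near +oo, coords f t = c) /\
    forall x, f x = wave (ctransfer z (right_part x p) c) x.
Proof.
move=> sp sf.
(* the coordinates at infinity are those at a point M beyond all sites *)
have [M nM] : exists M, forall u, M <= u -> u \notin sites p.
  by have /filter_ex[M hM] := near_pinfty_nosite p; exists M.
have tail x : right_part x p = [::] -> x \notin sites p -> coords f x =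
  coords f M.
  move=> e xp; have no t : x <= t -> t \notin sites p.
    by rewrite le_eqVlt => /orP[/eqP <- //|]; exact: right_part_nil.
  have [xM|/ltW Mx] := leP x M.
    by apply: (coords_const sf) => // t /andP[/no].
  by apply/esym/(coords_const sf) => // t /andP[/nM].
exists (coords f M); split.
  near=> t; apply/tail; first by near: t; exact: near_pinfty_part.
  suff : forall u, t <= u -> u \notin sites p by apply.
  by near: t; exact: near_pinfty_nosite.
have H x : x \notin sites p -> coords f x =
  ctransfer z (right_part x p) (coords f M).
  have [n] := ubnP (size (right_part x p)); elim: n x => // n IH x;
    rewrite ltnS => szx xp.
  case e : (right_part x p) => [|s r] /=; first exact: tail.
  have [sinp xs er between] := right_part_next sp e.
  have [y sy no] := right_gap sp er.
  have ey : right_part y p = r by rewrite -er; apply: right_part_eq;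
    rewrite ?ltW.
  rewrite -/(ctransfer z r _) -{1}ey -IH; last 2 first.
  - by rewrite ey; move: szx; rewrite e.
  - exact: no.
  apply: (solution_jump sf sinp); near=> t.
    have xt : x <= t by rewrite ltW//; near: t; exact: nbhs_left_gt.
    have ts : t < site s by near: t; exact: nbhs_left_lt.
    apply/esym/(coords_const sf) => // u /andP[xu ut]; move: xu.
    rewrite le_eqVlt => /orP[/eqP <- //|xu].
    by apply: between => //; rewrite (le_lt_trans ut).
  have ty : t <= y by rewrite ltW//; near: t; exact: nbhs_right_lt.
  have st : site s < t by near: t; exact: nbhs_right_gt.
  apply: (coords_const sf) => // u /andP[tu uy].
  by apply: no => //; rewrite (lt_le_trans _ tu).
move=> x; apply: (solution_right_value sf); near=> t.
have -> : right_part x p = right_part t p.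
  by apply/esym; near: t; exact: near_right_part.
by apply: H; near: t; exact: near_right_nosite.
Unshelve. all: by end_near. Qed.

(** The solution with coefficients [c] near +oo. *)
Definition wave_sol z p c x := wave (ctransfer z (right_part x p) c) x.

Lemma wave_sol_nosite z p c x : x \notin sites p ->
  let C := ctransfer z (right_part x p) c in
  [/\ derivableC (wave_sol z p c) x, deriveC (wave_sol z p c) x =
    wave (dwave C) x,
      derivableC (deriveC (wave_sol z p c)) x &
      - deriveC (deriveC (wave_sol z p c)) x + 4^-1 * wave_sol z p c x = 0].
Proof.
move=> xp C; have nC : \forall t \near x, wave_sol z p c t = wave C t.
  by apply: filterS (near_part_nosite xp) => t; rewrite /wave_sol => ->.
have [d1 e1] := near_wave nC.
have nD : \forall t \near x, deriveC (wave_sol z p c) t = wave (dwave C) t.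
  by apply: filterS (near_join nC) => t /near_wave[].
have [d2 e2] := near_wave nD.
split=> //; rewrite e2 /wave_sol -/C /wave /dwave /=.
have two0 := two_neq0 R; have four0 : (4 : R[i]) != 0 by rewrite pnatr_eq0.
by field.
Qed.

Lemma ge_part_site p s : sites_sorted p -> s \in p ->
  [seq u <- p | site s <= site u] = s :: right_part (site s) p.
Proof.
elim: p => // t p IH sp; have lts := order_path_min lt_trans sp;
  rewrite all_map in lts.
rewrite in_cons => /orP[/eqP ->|sinp].
  rewrite right_part_head//= lexx; congr (_ :: _).
  by apply/all_filterP; apply: sub_all lts => u /= /ltW.
have ts : site t < site s := allP lts _ sinp.
by rewrite (right_part_mem sp sinp) -(IH (path_sorted sp) sinp) /= leNgt ts.
Qed.

(** At a site the function is defined by its coefficients on the right; those on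
    the left give the same value, which is the continuity of the solution. *)
Lemma wave_sol_left z p c x : sites_sorted p ->
  wave (ctransfer z [seq s <- p | x <= site s] c) x = wave_sol z p c x.
Proof.
move=> sp; have [/mapP[s sinp ->]|xp] := boolP (x \in sites p).
  by rewrite ge_part_site//=;
    have [] := cross_wave z s (ctransfer z (right_part (site s) p) c).
by rewrite right_part_nosite.
Qed.

Lemma cvgC_wave_sol_left z p c x : sites_sorted p ->
  cvgC (wave_sol z p c) x^'- (wave_sol z p c x).
Proof.
move=> sp; rewrite -wave_sol_left//; apply: cvgC_near (cvgC_wave_left _ x).
by apply: filterS (near_left_part p x) => t <-.
Qed.

Lemma cvgC_wave_sol_right z p c x : cvgC (wave_sol z p c) x^'+
  (wave_sol z p c x).
Proof.
rewrite {2}/wave_sol; apply: cvgC_near (cvgC_wave_right _ x).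
by apply: filterS (near_right_part p x) => t <-.
Qed.

Lemma continuousC_wave_sol z p c : sites_sorted p ->
  continuousC (wave_sol z p c).
Proof.
move=> sp; split=> x; apply/left_right_continuousP.
  by have [? _] := cvgC_wave_sol_left z c x sp;
    have [? _] := cvgC_wave_sol_right z p c x.
by have [_ ?] := cvgC_wave_sol_left z c x sp; have [_ ?] := cvgC_wave_sol_right
  z p c x.
Qed.

Lemma wave_sol_solution z p c : sites_sorted p ->
  is_solution p z (wave_sol z p c).
Proof.
move=> sp; split; first exact: continuousC_wave_sol.
  by move=> x /(wave_sol_nosite z c)[].
move=> s sinp; pose Cr := ctransfer z (right_part (site s) p) c.
exists (wave (dwave (ccross z s Cr)) (site s)), (wave (dwave Cr) (site s)).
have [x1 x2] := cross_wave z s Cr; split; last exact: x2.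
  apply: cvgC_near (cvgC_wave_left _ _); near=> t.
  have [|_ -> _ _] := @wave_sol_nosite z p c t.
    by near: t; exact: near_left_nosite.
  congr (wave (dwave _) _); have -> : right_part t p = s :: right_part (site s)
    p.
    by rewrite -ge_part_site//; near: t; exact: near_left_part.
  by [].
apply: cvgC_near (cvgC_wave_right _ _); near=> t.
have [|_ -> _ _] := @wave_sol_nosite z p c t.
  by near: t; exact: near_right_nosite.
by congr (wave (dwave (ctransfer _ _ _)) _); near: t; exact: near_right_part.
Unshelve. all: by end_near. Qed.

End Solutions.

(** * Eigenvalues and norming constants *)

Section Spectrum.
Variable R : realType.
Implicit Types (s : R * R * R) (p q : pair_data R) (a b x y t : R)
  (c : R[i] * R[i]).
Implicit Types (z : R[i]) (f g : R -> R[i]).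

Lemma ctransfer_scale z p k c :
  ctransfer z p (k * c.1, k * c.2) = (k * (ctransfer z p c).1,
    k * (ctransfer z p c).2).
Proof.
elim: p => //= s p ->; rewrite /ccross /cross /=.
by case: (ctransfer z p c) => u w /=; congr (_, _); ring.
Qed.

Lemma near_pinfty_wave f c : (\forall t \near +oo, f t = wave c t) ->
  \forall t \near +oo, coords f t = c.
Proof.
move=> [M [Mr fM]]; exists M; split=> // t Mt.
have nt : \forall u \near t, f u = wave c u.
  by apply: filterS (lt_nbhsr Mt) => u; exact: fM.
have [_ e2] := near_wave nt; have [w1 w2] := wave_coords f t.
by apply: (wave_inj (x := t)); rewrite -?w1 -?w2// fM.
Qed.

Lemma wave_sol_pinfty z p c : \forall t \near +oo, wave_sol z p c t = wave c t.
Proof. by apply: filterS (near_pinfty_part p) => t; rewrite /wave_sol => ->.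
Qed.

Lemma wave_decay t : wave (1, 0) t = (expR (- t / 2))%:C :> R[i].
Proof. by rewrite /wave /= mul1r mul0r addr0. Qed.

(** Existence and uniqueness of the solution defining [phi_plus]. *)
Lemma phi_plusE p z : sites_sorted p -> phi_plus p z = wave_sol z p (1, 0).
Proof.
move=> sp; apply: xget_unique.
  split; first exact: wave_sol_solution.
  by apply: filterS (wave_sol_pinfty z p (1, 0)) => t ->; rewrite wave_decay.
move=> f [sf fe]; have [c [fc fE]] := solution_structure sp sf.
have fc1 : \forall t \near +oo, coords f t = (1, 0).
  by apply: near_pinfty_wave; apply: filterS fe => t ->; rewrite wave_decay.
have [t [<- ec]] := filter_ex (filterI fc1 fc).
by apply/funext => x; rewrite fE -ec.
Qed.

Lemma wave_sol_minfty z p c : exists T, forall x, x <= T ->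
  wave_sol z p c x = wave (ctransfer z p c) x.
Proof.
suff [T hT] : exists T, forall x, x <= T -> right_part x p = p.
  by exists T => x /hT; rewrite /wave_sol => ->.
elim: p => [|s p [T hT]]; first by exists 0.
exists (Num.min T (site s - 1)) => x; rewrite le_min => /andP[xT xs].
by rewrite /right_part /= (le_lt_trans xs) ?gtrBl// -/(right_part x p) hT.
Qed.

(** A bounded solution near +oo has no growing component. *)
Lemma rwave_bounded a b M T : (forall t, T <= t -> `|rwave a b t| <= M) -> b =
  0.
Proof.
move=> hM; apply/eqP/negPn/negP => b0; have nb : 0 < `|b| by rewrite normr_gt0.
(* with e^{t/2} >= 1 + t/2, this t makes |b| e^{t/2} exceed M + |a| *)
pose t := Num.max T (Num.max 0 (2 * (M + `|a|) / `|b|)).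
have Tt : T <= t by rewrite le_max lexx.
have t0 : 0 <= t by rewrite !le_max lexx orbT.
have tb : 2 * (M + `|a|) / `|b| <= t by rewrite !le_max lexx !orbT.
have h : `|b| * expR (t / 2) <= M + `|a|.
  have -> : `|b| * expR (t / 2) = `|rwave a b t - a * expR (- t / 2)|.
    by rewrite /rwave addrAC subrr add0r normrM (ger0_norm (expR_ge0 _)).
  rewrite (le_trans (ler_normB _ _))// lerD ?hM// normrM
    (ger0_norm (expR_ge0 _)).
  by rewrite ler_piMr// expR_le1 mulNr oppr_le0 divr_ge0.
have : `|b| * (1 + t / 2) <= M + `|a|.
  by apply: le_trans h; rewrite ler_wpM2l// expR_ge1Dx.
rewrite ler_pdivrMr// in tb.
by rewrite leNgt => /negP; apply; rewrite mulrDr mulr1; lra.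
Qed.

Lemma rwaveN a b t : rwave a b (- t) = rwave b a t.
Proof. by rewrite /rwave opprK addrC. Qed.

Lemma rwave_bounded_left a b M T : (forall t, t <= T -> `|rwave a b t| <= M) ->
  a = 0.
Proof.
move=> hM; apply: (@rwave_bounded b a M (- T)) => t Tt.
by rewrite -rwaveN hM// lerNl.
Qed.

Lemma Re_le_normc (w : R[i]) : `|complex.Re w| <= Normc.normc w.
Proof. by case: w => u v /=; rewrite -sqrtr_sqr ler_wsqrtr// lerDl sqr_ge0.
Qed.

Lemma Im_le_normc (w : R[i]) : `|complex.Im w| <= Normc.normc w.
Proof. by case: w => u v /=; rewrite -sqrtr_sqr ler_wsqrtr// lerDr sqr_ge0. Qed.

Lemma normc_le (w : R[i]) : Normc.normc w <= `|complex.Re w| + `|complex.Im w|.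
Proof.
case: w => u v /=; rewrite -[leRHS]ger0_norm ?addr_ge0// -sqrtr_sqr
  ler_wsqrtr//.
rewrite -[u ^+ 2]real_normK ?num_real// -[v ^+ 2]real_normK ?num_real//.
by rewrite sqrrD -addrA lerD2l lerDr mulrn_wge0// mulr_ge0.
Qed.

Definition cslope z p := (ctransfer z p (1, 0)).1.

(** Boundedness near +oo makes the solution a multiple of phi_+, and boundedness
    near -oo makes its coefficient of e^{-x/2} vanish there. *)
Lemma eigenvalue_cslope0 p z : sites_sorted p -> is_eigenvalue p z ->
  cslope z p = 0.
Proof.
move=> sp [f [sf [x0 fx0] [M fM]]]; have [c [_ fE]] := solution_structure sp sf.
have {}fE : f = wave_sol z p c by apply/funext => x; rewrite fE.
have [T0 [_ hT]] := wave_sol_pinfty z p c.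
have c2 : c.2 = 0.
  have bound t : T0 + 1 <= t -> Normc.normc (wave c t) <= M.
    move=> Tt; rewrite -hT -?fE//=.
    by rewrite (lt_le_trans _ Tt)// ltrDl.
  apply: complexP => /=.
    apply: (@rwave_bounded (complex.Re c.1) _ M (T0 + 1)) => t /bound.
    by rewrite -Re_wave; apply: le_trans; exact: Re_le_normc.
  apply: (@rwave_bounded (complex.Im c.1) _ M (T0 + 1)) => t /bound.
  by rewrite -Im_wave; apply: le_trans; exact: Im_le_normc.
have cE : c = (c.1 * 1, c.1 * 0).
  by rewrite mulr1 mulr0; case: (c) c2 => ? ? /= ->.
have [T1 hT1] := wave_sol_minfty z p c.
have C1 : (ctransfer z p c).1 = 0.
  have bound t : t <= T1 -> Normc.normc (wave (ctransfer z p c) t) <= M.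
    by move=> tT; rewrite -hT1// -fE.
  set C := ctransfer z p c in bound *; apply: complexP => /=.
    apply: (@rwave_bounded_left _ (complex.Re C.2) M T1) => t /bound.
    by rewrite -Re_wave; apply: le_trans; exact: Re_le_normc.
  apply: (@rwave_bounded_left _ (complex.Im C.2) M T1) => t /bound.
  by rewrite -Im_wave; apply: le_trans; exact: Im_le_normc.
move: C1; rewrite cE (ctransfer_scale z p c.1 (1, 0)) /= -/(cslope z p) => /eqP.
rewrite mulf_eq0 => /orP[/eqP c1|/eqP //].
move: fx0; rewrite fE /wave_sol cE c1 (ctransfer_scale z _ 0 (1, 0)) !mul0r.
by rewrite /wave /= !mul0r addr0 eqxx.
Qed.

Lemma continuous_bounded (g : R -> R) (u v : R) : continuous g ->
  exists M, forall t, u <= t <= v -> `|g t| <= M.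
Proof.
move=> cg; have [uv|vu] := leP u v; last first.
  by exists 0 => t /andP[ut tv]; have := lt_le_trans vu (le_trans ut tv);
    rewrite ltxx.
have cn : {within `[u, v], continuous (fun t => `|g t|)}.
  by apply: continuous_subspaceT => t; apply: continuous_comp;
    [exact: cg|exact: norm_continuous].
have [m _ hm] := EVT_max uv cn.
by exists `|g m| => t tuv; apply: hm; rewrite in_itv.
Qed.

(** The function phi_+ is then bounded near both ends, and continuous. *)
Lemma cslope0_eigenvalue p z : sites_sorted p -> cslope z p = 0 ->
  is_eigenvalue p z.
Proof.
move=> sp W0; pose f := wave_sol z p (1, 0); exists f.
have sf := wave_sol_solution z (1, 0) sp; have [[cR cI] _ _] := sf.
have [T0 [_ hT]] := wave_sol_pinfty z p (1, 0).
have [T1 hT1] := wave_sol_minfty z p (1, 0).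
split=> //.
  exists (T0 + 1); rewrite /f hT ?ltrDl//= wave_decay fmorph_eq0.
  by rewrite gt_eqF ?expR_gt0.
pose w := (ctransfer z p (1, 0)).2.
have [M1 hM1] := continuous_bounded T1 (T0 + 1) cR.
have [M2 hM2] := continuous_bounded T1 (T0 + 1) cI.
exists (`|M1| + `|M2| + expR (- T0 / 2)
  + (`|complex.Re w| + `|complex.Im w|) * expR (T1 / 2)) => x.
have e0 := expR_ge0 (- T0 / 2).
have w0 : 0 <= (`|complex.Re w| + `|complex.Im w|) * expR (T1 / 2).
  by rewrite mulr_ge0 ?expR_ge0 ?addr_ge0.
have [xT1|T1x] := leP x T1.
  apply: (@le_trans _ _ ((`|complex.Re w| + `|complex.Im w|) * expR (T1 / 2)));
    last first.
    by rewrite lerDr !addr_ge0.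
  rewrite /f hT1// (le_trans (normc_le _))//.
  rewrite Re_wave Im_wave -/(cslope z p) W0 /rwave /= !mul0r !add0r -/w !normrM.
  rewrite -mulrDl ler_wpM2l ?addr_ge0// ger0_norm ?expR_ge0// ler_expR.
  by rewrite ler_pM2r.
have [xT0|T0x] := leP x (T0 + 1).
  rewrite (le_trans (normc_le _))// -!addrA lerD//.
    by rewrite (le_trans _ (ler_norm _))// hM1// ltW.
  rewrite -[leLHS]addr0 lerD ?addr_ge0//.
  by rewrite (le_trans _ (ler_norm _))// hM2// ltW.
have T0x' : T0 < x by rewrite (lt_trans _ T0x)// ltrDl.
apply: (@le_trans _ _ (expR (- T0 / 2))); last first.
  have := normr_ge0 M1; have := normr_ge0 M2; move: e0 w0.
  by set e := expR _; set d := _ * expR _; lra.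
rewrite /f hT// wave_decay /= expr0n /= addr0 sqrtr_sqr ger0_norm ?expR_ge0//.
by rewrite ler_expR ler_pM2r// lerN2 ltW.
Qed.

Lemma ctransfer_eval p z :
  ctransfer z p (1, 0) = ((map_poly (real_complex R) (pstate p).1).[z],
                          (map_poly (real_complex R) (pstate p).2).[z]).
Proof.
rewrite /ctransfer /pstate /transfer; elim: p => [|s p /= ->] /=.
  by rewrite rmorph1 rmorph0 !hornerE.
case: (foldr _ _ p) => u w; rewrite /ccross /pcross /cross /=.
rewrite rmorphB !rmorphD !rmorphM !rmorphD !rmorphM /= !map_polyC map_polyX /=.
by rewrite !hornerE.
Qed.

Lemma eigenvalueP p z : sites_sorted p ->
  is_eigenvalue p z <-> root (map_poly (real_complex R) (slope p)) z.
Proof.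
move=> sp; split=> [/(eigenvalue_cslope0 sp)|/rootP r].
  by rewrite /cslope ctransfer_eval /= => /rootP.
by apply: cslope0_eigenvalue => //; rewrite /cslope ctransfer_eval.
Qed.

Lemma phi_plus_value p (lam : R) a : sites_sorted p ->
  phi_plus p lam%:C a = ((right_value a p).[lam] * expR (- a / 2))%:C.
Proof.
move=> sp; rewrite phi_plusE// /wave_sol ctransfer_eval /wave /= !horner_map /=.
rewrite -!rmorphM -rmorphD; congr (_%:C).
have e1 : expR a * expR (- a / 2) = expR (a / 2).
  by rewrite -expRD; congr expR; field.
by rewrite /right_value /value !hornerE -e1; ring.
Qed.

Lemma normc_real (x : R) : Normc.normc x%:C ^+ 2 = x ^+ 2.
Proof. by rewrite /= expr0n /= addr0 sqr_sqrtr ?sqr_ge0. Qed.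

Lemma normc_phi_plus p (lam : R) a : sites_sorted p ->
  Normc.normc (phi_plus p lam%:C a) ^+ 2 = (right_value a p).[lam] ^+ 2 * expR
    (- a).
Proof.
move=> sp; rewrite phi_plus_value// normc_real exprMn; congr (_ * _).
by rewrite expr2 -expRD -splitr.
Qed.

Lemma gamma_sqE p (lam : R) : sites_sorted p -> gamma_sq p lam =
  (energy p).[lam].
Proof.
move=> sp; rewrite energy_sum// horner_sum /gamma_sq /integral_omega
  /integral_v.
rewrite mulr_sumr -big_split /=; apply: eq_bigr => s _.
rewrite normc_phi_plus//; move: (right_value _ _) => A.
rewrite !hornerM hornerD hornerC hornerZ hornerX hornerC.
by rewrite -mulr_natr; ring.
Qed.

End Spectrum.

(** * Spectral data *)

Section Data.
Variables (R : realType) (a : R) (N : nat) (lam : 'I_N -> R).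
Implicit Types (p q : pair_data R) (phi : 'I_N -> R[i]).

Lemma is_pairE p : is_pair p <-> (0 < size p)%N /\ weak_pair p.
Proof.
split=> [[sz sp gp]|[sz /andP[sp gp]]].
  split=> //; apply/andP; split=> //; apply/allP => s /gp[v0 wv].
  by rewrite /good_site /good_potential v0.
by split=> // s /(allP gp)/andP[v0 wv].
Qed.

Definition weight phi i : R := Normc.normc (phi i) ^+ 2.

Lemma weight_gt0 phi i : phi i <> 0 -> 0 < weight phi i.
Proof.
move=> h; rewrite exprn_even_gt0//=; apply/negP => /eqP /Normc.eq0_normc;
  exact: h.
Qed.

Lemma weight_normalized q i : weak_pair q ->
  weight (fun i => normalized_eigenfunction q (lam i) a) i =
  (right_value a q).[lam i] ^+ 2 * expR (- a)
  / Num.sqrt (lam i * (energy q).[lam i]) ^+ 2.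
Proof.
move=> /andP[sq _]; rewrite /weight /normalized_eigenfunction Normc.normcM
  Normc.normcV.
by rewrite exprMn exprVn normc_phi_plus// normc_real gamma_sqE.
Qed.

(** With w the coefficient of phi_+ to the left of all sites, phi_+(a)^2 = w K
    and gamma^2 = - w V' at an eigenvalue. If varphi_i(a) <> 0, the square root
    normalizing the eigenfunction does not vanish, so lam gamma^2 > 0; in
    particular V' <> 0, which makes the eigenvalue a simple root of V. *)
Lemma green_residue q phi i : weak_pair q ->
  interior_spectral_data q a lam phi ->
  phi i <> 0 ->
  [/\ root (slope q) (lam i), (slope q)^`().[lam i] != 0, lam i != 0 &
      (green_num a q).[lam i] = -
        (lam i * weight phi i * (slope q)^`().[lam i])].
Proof.
move=> wq [[_ ev] phiE] /weight_gt0 w0; have sq : sites_sorted q by case/andP: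
  wq.
have rt : root (slope q) (lam i).
  have : is_eigenvalue q (lam i)%:C by apply/ev; exists i.
  by move=> /(eigenvalueP _ sq); rewrite rootE horner_map fmorph_eq0.
have := weight_normalized i wq.
rewrite {1}/weight -phiE -/(weight phi i) right_value_at_root//.
rewrite energy_at_root//; have := pstate2_at_root rt.
set w := (pstate q).2.[_]; set d := _^`().[_] => wn0.
set g := _ * - _; have [g0|g0] := leP g 0.
  by move=> we; move: w0; rewrite we ler0_sqrtr// expr0n invr0 mulr0 ltxx.
rewrite sqr_sqrtr ?ltW// => we; have gn0 : g != 0 by rewrite gt_eqF.
have d0 : d != 0 by apply: contraNneq gn0 => d0;
  rewrite /g d0 mulr0 oppr0 mulr0.
have l0 : lam i != 0 by apply: contraNneq gn0 => l0; rewrite /g l0 mul0r.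
split=> //; rewrite /green_num hornerM.
apply: (mulfI wn0); rewrite we /g; field.
by rewrite d0 l0 wn0.
Qed.

Lemma increasing_inj (lam_lt : forall i j : 'I_N, (i < j)%N -> lam i < lam j) :
  injective lam.
Proof.
move=> i j e; apply/val_inj/eqP; rewrite eqn_leq; apply/andP; split;
  rewrite leqNgt;
  by apply/negP => /lam_lt; rewrite e ltxx.
Qed.

Lemma spectrum_simple_roots q phi : weak_pair q ->
  interior_spectral_data q a lam phi ->
  (forall i, phi i <> 0) -> simple_roots (slope q) [seq lam i | i <- enum 'I_N].
Proof.
move=> wq data phi0; have sq : sites_sorted q by case/andP: wq.
have [[lt ev] _] := data.
have V0 : slope q != 0 by rewrite horner0_neq0// slope0.
have rootV z : root (map_poly (real_complex R) (slope q)) z -> exists i, z =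
  (lam i)%:C.
  by move=> /(eigenvalueP _ sq)/ev.
have rootR x : root (slope q) x -> exists i, x = lam i.
  move=> rx; have [|i [->]] := rootV x%:C; last by exists i.
  by rewrite rootE horner_map fmorph_eq0.
have [z /rootV[i ->] //|x /rootR[i ->]|ps sV] := simple_roots_exist V0.
  by have [] := green_residue wq data (phi0 i).
have [_ ups eV] := sV; split=> //.
  by rewrite map_inj_uniq ?enum_uniq//; exact: increasing_inj.
rewrite {1}eV; congr (_ *: _); apply: perm_big; apply: uniq_perm => // [|x].
  by rewrite map_inj_uniq ?enum_uniq//; exact: increasing_inj.
rewrite -(simple_roots_root _ sV); apply/idP/mapP => [/rootR[i ->]|[i _ ->]].
  by exists i; rewrite ?mem_enum.
by have [] := green_residue wq data (phi0 i).
Qed.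

(** Both slopes have the same simple roots and are 1 at 0. Both numerators have
    degree at most N, and by [green_residue] the same values at N + 1 points. *)
Lemma data_determine_slope_green p q phi phi' : weak_pair p -> weak_pair q ->
  interior_spectral_data p a lam phi -> interior_spectral_data q a lam phi' ->
  (forall i, phi i <> 0) -> (forall i, Normc.normc (phi' i) =
    Normc.normc (phi i)) ->
  slope q = slope p /\ green_num a q = green_num a p.
Proof.
move=> wp wq dp dq phi0 same.
have phi'0 i : phi' i <> 0.
  move=> e; apply: (phi0 i); apply: Normc.eq0_normc; rewrite -same e;
    exact: Normc.normc0.
have sp := spectrum_simple_roots wp dp phi0; have sq :=
  spectrum_simple_roots wq dq phi'0.
have eV : slope q = slope p.
  apply: (simple_roots_eq sq sp); rewrite ?slope0// => x.
  by rewrite (simple_roots_root _ sp) (simple_roots_root _ sq).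
split=> //; apply/eqP; rewrite -subr_eq0; apply/eqP.
apply: (roots_geq_poly_eq0 (rs := 0 :: [seq lam i | i <- enum 'I_N])).
- rewrite /= rootE hornerD hornerN !green_num0 subrr eqxx /=;
  apply/allP => x /mapP[i _ ->].
  have [_ _ _ e1] := green_residue wp dp (phi0 i); have [_ _ _ e2] :=
    green_residue wq dq (phi'0 i).
  by rewrite rootE hornerD hornerN e1 e2 eV /weight same subrr.
- have [_ ul _] := sp; rewrite /= ul andbT -(simple_roots_root _ sp) rootE
  slope0 oner_eq0//.
- rewrite (leq_trans (size_polyD _ _))// size_polyN /= -(simple_roots_size sp)
  geq_max.
  have /andP[-> _] := size_green_num_le a wp.
  by rewrite -eV; have /andP[-> _] := size_green_num_le a wq.
Qed.

(** Conversely the eigenvalues are the roots of V, and the weights are recovered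
    from the residues of K / V. *)
Lemma data_of_slope_green p q phi : weak_pair p -> weak_pair q ->
  interior_spectral_data p a lam phi -> (forall i, phi i <> 0) ->
  slope q = slope p -> green_num a q = green_num a p ->
  let phi' i := normalized_eigenfunction q (lam i) a in
  interior_spectral_data q a lam phi' /\
  forall i, Normc.normc (phi' i) = Normc.normc (phi i).
Proof.
move=> wp wq dp phi0 eV eK phi'.
have [sp sq] : sites_sorted p /\ sites_sorted q by case/andP: wp; case/andP: wq.
split.
  split=> //; have [[lt ev] _] := dp; split=> // z; rewrite -ev.
  by rewrite eigenvalueP// eV -eigenvalueP.
move=> i; have [rt d0 l0 e] := green_residue wp dp (phi0 i).
have w0 := weight_gt0 (phi0 i).
have normc_ge0 (u : R[i]) : 0 <= Normc.normc u by case: u => *;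
  exact: sqrtr_ge0.
apply/eqP; rewrite -(eqrXn2 (n := 2))//.
rewrite -[X in X == _]/(weight phi' i) -[X in _ == X]/(weight phi i)
  weight_normalized//.
have rq : root (slope q) (lam i) by rewrite eV.
rewrite right_value_at_root// energy_at_root// -hornerM -/(green_num a q) eK e
  eV.
have := pstate2_at_root rq; set w := (pstate q).2.[_]; set d :=
  _^`().[_] in d0 e * => wn0.
set g := lam i * - _; set r := weight phi i in w0 e *.
have E : w * - (lam i * r * d) = g * r by rewrite /g; ring.
(* the positivity of lam gamma^2 comes for free: g r is the square of phi_+ *)
have g0 : 0 < g.
  have : 0 < g * r.
    rewrite -E -e -eK /green_num hornerM -right_value_at_root// mulr_gt0
      ?expR_gt0//.
    rewrite exprn_even_gt0//=; apply/negP => /eqP A0.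
    have : (green_num a q).[lam i] = 0 by rewrite hornerM A0 mul0r.
    rewrite eK e => /eqP; rewrite oppr_eq0 mulf_eq0 (negPf d0) orbF.
    by rewrite mulf_eq0 (negPf l0)/= gt_eqF.
  by rewrite pmulr_lgt0.
by rewrite E sqr_sqrtr ?ltW// mulrC mulKf// gt_eqF.
Qed.

Lemma data_disjoint p phi : weak_pair p -> interior_spectral_data p a lam phi ->
  (forall i, phi i <> 0) -> disjoint_roots (green_num a p) (slope p).
Proof.
move=> wp dp phi0 x Kx; have sp := spectrum_simple_roots wp dp phi0.
rewrite (simple_roots_root _ sp); apply/negP => /mapP[i _ xE].
have [_ d0 l0 e] := green_residue wp dp (phi0 i).
move: Kx; rewrite rootE xE e oppr_eq0 mulf_eq0 (negPf d0) orbF mulf_eq0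
  (negPf l0)/=.
by rewrite gt_eqF// weight_gt0.
Qed.

Lemma pairs_with_dataE p phi : is_pair p ->
  interior_spectral_data p a lam phi ->
  (forall i, phi i <> 0) ->
  pairs_with_data a lam phi =
  [set q | [/\ weak_pair q, slope q = slope p & green_num a q = green_num a p]].
Proof.
move=> /is_pairE[szp wp] dp phi0; apply/seteqP; split=> q.
  move=> [/is_pairE[_ wq] [lam' [phi' [dq same]]]].
  have lamE : lam' = lam by apply/funext => i; case: (same i).
  rewrite lamE in dq.
  have same' i : Normc.normc (phi' i) = Normc.normc (phi i) by case: (same i).
  by have [eV eK] := data_determine_slope_green wp wq dp dq phi0 same'.
move=> [wq eV eK]; have [dq same] := data_of_slope_green wp wq dp phi0 eV eK.
split; last first.
  by exists lam, (fun i => normalized_eigenfunction q (lam i) a).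
apply/is_pairE; split=> //; rewrite lt0n size_eq0; apply/eqP => q0.
(* if q is empty then K = 1, the right values have no root, and p = q *)
have noroot t : weak_pair t -> green_num a t = green_num a p ->
  forall x, root (right_value a t) x = false.
  move=> wt et x; apply/negP => tx.
  have : root (green_num a q) x by rewrite eK -et rootM tx.
  by rewrite q0 /green_num /right_value /left_value !value_nil mulr1 rootE
    hornerC oner_eq0.
have pq : p = q.
  apply: (weak_pair_unique (a := a)) => //; first exact: data_disjoint dp phi0.
  by move=> x; rewrite !noroot.
by move: szp; rewrite pq q0.
Qed.

(** Partial fractions of K / V: both sides have degree at most N and the same
    values at 0 and at the eigenvalues. *)
Lemma green_num_expansion p phi : weak_pair p ->
  interior_spectral_data p a lam phi ->
  (forall i, phi i <> 0) ->
  green_num a p = alpha phi *: slope p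
    - \sum_(i < N) (lam i * weight phi i) *: cofactor (slope p) (lam i).
Proof.
move=> wp dp phi0; have sp := spectrum_simple_roots wp dp phi0.
have [_ ul _] := sp; have res i := green_residue wp dp (phi0 i).
have szV := simple_roots_size sp; rewrite size_map size_enum_ord in szV.
set rhs := _ - _.
apply/eqP; rewrite -subr_eq0; apply/eqP.
apply: (roots_geq_poly_eq0 (rs := 0 :: [seq lam i | i <- enum 'I_N])).
- rewrite /= rootE hornerD hornerN green_num0 /rhs.
  rewrite hornerD hornerN hornerZ slope0 mulr1 horner_sum /alpha.
  have -> : \sum_(i < N) ((lam i * weight phi i) *: cofactor (slope p)
    (lam i)).[0] =
      - \sum_(i < N) weight phi i.
    rewrite -sumrN; apply: eq_bigr => i _; have [rt _ l0 _] := res i.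
    have := slope0 p; rewrite {1}(cofactorK rt) hornerM hornerXsubC sub0r => c0.
    rewrite hornerZ; set c := _.[0] in c0 *.
    have -> : lam i * weight phi i * c = - weight phi i * (c * - lam i) by ring.
    by rewrite c0 mulr1.
  apply/andP; split; first by rewrite /weight; apply/eqP; ring.
  apply/allP => x /mapP[i _ ->]; have [rt _ _ e] := res i.
  rewrite rootE hornerD hornerN e hornerD hornerN hornerZ (rootP rt) mulr0 sub0r
    opprK.
  rewrite horner_sum (bigD1 i)//= big1 => [|j ji].
    by rewrite addr0 hornerZ -deriv_cofactor// addNr.
  have [rj _ _ _] := res j; rewrite hornerZ cofactor_root ?mulr0//.
  by rewrite (inj_eq (increasing_inj dp.1.1)) eq_sym.
- by rewrite /= ul andbT -(simple_roots_root _ sp) rootE slope0 oner_eq0.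
- rewrite (leq_trans (size_polyD _ _))// size_polyN /= size_map size_enum_ord
  geq_max -szV.
  have /andP[-> _] := size_green_num_le a wp.
  rewrite /rhs (leq_trans (size_polyD _ _))// geq_max size_scale_leq
    size_polyN/=.
  apply: (big_ind (fun h : {poly R} => (size h <= size (slope p))%N))
    => [|h1 h2 l1 l2|i _].
  + by rewrite size_poly0.
  + by rewrite (leq_trans (size_polyD _ _))// geq_max l1.
  + by rewrite (leq_trans (size_scale_leq _ _))// size_cofactor leq_pred.
Qed.

(** By the expansion of K / V, the coefficients of K in degrees N and N - 1 are
    alpha and, if alpha = 0, beta, up to the leading coefficient of V. If both
    vanish, deg V <= deg K + 2 prevents the degree from dropping further. *)
Lemma size_green_num p phi : weak_pair p ->
  interior_spectral_data p a lam phi ->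
  (forall i, phi i <> 0) ->
  (size (green_num a p)).-1 =
    if alpha phi != 0 then N else if beta lam phi != 0 then (N - 1)%N else
      (N - 2)%N.
Proof.
move=> wp dp phi0; have sp := spectrum_simple_roots wp dp phi0.
have szV := simple_roots_size sp; rewrite size_map size_enum_ord in szV.
have V0 : lead_coef (slope p) != 0 by have [V0 _ _] := sp;
  rewrite lead_coef_eq0.
have /andP[KV VK] := size_green_num_le a wp; rewrite szV in KV VK.
have KE := green_num_expansion wp dp phi0; set K := green_num a p in KE KV VK *.
have res i := green_residue wp dp (phi0 i).
have KN : K`_N = alpha phi * lead_coef (slope p).
  rewrite KE coefD coefN coefZ lead_coefE szV coef_sum big1 ?subr0// => i _.
  by rewrite coefZ [X in _ * X]nth_default ?mulr0// size_cofactor szV.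
have [al0|al0] := eqVneq (alpha phi) 0; last first.
  have : K`_N != 0 by rewrite KN mulf_neq0.
  move=> KN0 /=; suff -> : size K = N.+1 by [].
  apply/eqP; rewrite eqn_leq KV ltnNge; apply: contraNN KN0 => ?.
  by rewrite nth_default.
have KN1 : K`_N.-1 = beta lam phi * lead_coef (slope p).
  rewrite KE al0 scale0r sub0r coefN coef_sum /beta mulNr mulr_suml;
    congr (- _).
  apply: eq_bigr => i _; have [rt _ _ _] := res i.
  by rewrite coefZ -(lead_coef_cofactor rt) lead_coefE size_cofactor szV.
rewrite al0 mul0r in KN; have KN' := size_drop_coef KV KN.
have N0 : (0 < N)%N.
  rewrite lt0n; apply/negP => /eqP N0; move: KN';
    rewrite N0 leqn0 size_poly_eq0.
  by rewrite (negPf (horner0_neq0 (green_num0 a p))).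
have [be0|be0] /= := eqVneq (beta lam phi) 0.
  rewrite be0 mul0r in KN1; have KN2 : (size K <= N.-1)%N.
    by apply: size_drop_coef => //; rewrite prednK.
  have -> : size K = N.-1.
    by apply/eqP; rewrite eqn_leq KN2 -subn1 leq_subLR add1n -ltnS.
  by rewrite -!subn1 -subnDA.
have : K`_N.-1 != 0 by rewrite KN1 mulf_neq0.
move=> KN10; rewrite subn1; congr _.-1.
apply/eqP; rewrite eqn_leq KN' leqNgt; apply: contraNN KN10 => szK.
by rewrite nth_default// -ltnS prednK.
Qed.

End Data.


Theorem theorem3p9 (R : realType) (a : R) (N : nat)
    (lam : 'I_N -> R) (phi : 'I_N -> R[i])
    (hdata : exists p : pair_data R,
       is_pair p /\ interior_spectral_data p a lam phi)
    (hphi : forall i : 'I_N, phi i <> 0) :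
  [/\ alpha phi = 0 /\ beta lam phi = 0 ->
        (pairs_with_data a lam phi #= `I_(2 ^ (N - 2))%N)%card,
      alpha phi = 0 /\ beta lam phi <> 0 ->
        (pairs_with_data a lam phi #= `I_(2 ^ (N - 1))%N)%card &
      alpha phi <> 0 ->
        (pairs_with_data a lam phi #= `I_(2 ^ N)%N)%card].
Proof.
have [p [pp data]] := hdata; have [_ wp] := (is_pairE p).1 pp.
have count := card_isospectral wp (data_disjoint wp data hphi).
rewrite -(pairs_with_dataE pp data hphi) (size_green_num wp data hphi) in count.
split=> [[al0 be0]|[al0 /eqP be0]|/eqP al0]; move: count.
- by rewrite al0 be0 eqxx.
- by rewrite al0 eqxx be0.
- by rewrite al0.
Qed.
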